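(* Let $k\geq 1$ be an integer and let $H$ be a graph that is KNRS. Then: (a) the $(2k-1)$-subdivision $H^{(2k-1)}$ is Sidorenko, and (b) the $2k$-subdivision $H^{(2k)}$ is weakly-KNRS.
   Context: All graphs are finite and simple. For graphs $H,G$, a homomorphism from $H$ to $G$ is a map $f:V(H)\to V(G)$ with $f(u)f(v)\in E(G)$ whenever $uv\in E(H)$; the homomorphism density $t(H,G)$ is the probability that a uniformly random map $V(H)\to V(G)$ is a homomorphism. For an integer $s\geq 1$, the $s$-subdivision $H^{(s)}$ of $H$ is obtained by replacing each edge $uv$ of $H$ by a path of length $s+1$ between $u$ and $v$, these paths being internally vertex-disjoint. A bipartite graph $H$ is Sidorenko if $t(H,G)\geq t(K_2,G)^{|E(H)|}$ for every graph $G$. An $n$-vertex graph $G$ is $(\rho,d)$-dense if every vertex subset $X$ with $|X|\geq \rho n$ spans at least $\frac d2|X|^2$ edges. A graph $H$ is KNRS if for all reals $d,\varepsilon>0$ there is $\rho=\rho(d,H,\varepsilon)>0$ such that $t(H,G)\geq(1-\varepsilon)d^{|E(H)|}$ for every sufficiently large $(\rho,d)$-dense graph $G$. A graph $H$ is weakly-KNRS if there is a constant $c_H\in(0,1]$ such that for every real $d>0$ there is $\rho=\rho(d,H)>0$ with $t(H,G)\geq c_H\, d^{|E(H)|}$ for every sufficiently large $(\rho,d)$-dense graph $G$. *)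

(* Defs.v *)
From mathcomp Require Import all_boot all_order all_algebra.
From mathcomp Require Import reals.

Set Implicit Arguments.
Unset Strict Implicit.
Unset Printing Implicit Defensive.

Import Order.TTheory GRing.Theory Num.Theory.
Local Open Scope ring_scope.

Record sgraph := SGraph {
  vertex :> finType;
  adj : rel vertex;
  adj_sym : symmetric adj;
  adj_irrefl : irreflexive adj }.

Definition edges (G : sgraph) : {set {set G}} :=
  [set [set p.1; p.2] | p : G * G & adj p.1 p.2].

Definition edges_in (G : sgraph) (X : {set G}) : {set {set G}} :=
  [set e in edges G | e \subset X].

Definition bipartite (G : sgraph) : Prop :=
  exists A : {set G}, forall u v : G, adj u v -> (u \in A) != (v \in A).

Section CompleteGraph.
Variable n : nat.

Definition complete_adj : rel 'I_n := fun i j => i != j.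

Lemma complete_adj_sym : symmetric complete_adj.
Proof. by move=> i j; rewrite /complete_adj eq_sym. Qed.

Lemma complete_adj_irrefl : irreflexive complete_adj.
Proof. by move=> i; rewrite /complete_adj eqxx. Qed.

Definition complete_graph : sgraph :=
  SGraph complete_adj_sym complete_adj_irrefl.
End CompleteGraph.

(* The vertices of the s-subdivision are those of H together with s new ones
   for each edge.  To know in which order the new vertices of an edge are
   traversed, each edge {u, v} is represented by the single pair (u, v) in
   which u comes first in the enumeration of the vertices of H. *)
Section Subdivision.
Variables (s : nat) (H : sgraph).

Definition oriented_edge : pred (H * H) :=
  fun p => adj p.1 p.2 && (enum_rank p.1 < enum_rank p.2)%N.

Definition subdiv_vertex : finType :=
  (H + {p : H * H | oriented_edge p} * 'I_s)%type.

(* Vertex number i, for 0 <= i <= s + 1, of the path replacing the edge e. *)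
Definition subdiv_path (e : {p : H * H | oriented_edge p}) (i : nat) :
    subdiv_vertex :=
  if i is j.+1 then
    if insub j is Some j' then inr (e, j') else inl (val e).2
  else inl (val e).1.

Definition subdiv_adj : rel subdiv_vertex := fun x y =>
  [exists e, exists i : 'I_s.+1,
    ((x == subdiv_path e i) && (y == subdiv_path e i.+1)) ||
    ((y == subdiv_path e i) && (x == subdiv_path e i.+1))].

Lemma subdiv_adj_sym : symmetric subdiv_adj.
Proof.
by move=> x y; apply: eq_existsb => e; apply: eq_existsb => i; rewrite orbC.
Qed.

Lemma subdiv_path_neq e (i : 'I_s.+1) :
  subdiv_path e i != subdiv_path e i.+1.
Proof.
case: i => -[|i] ltis /=.
  case: insubP => //= _.
  case: e => -[u v] /= /andP[uv _]; apply/eqP => -[E].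
  by rewrite /= E adj_irrefl in uv.
rewrite insubT; case: insubP => [k _ ki|] //=.
by apply/eqP => -[ik]; move: ki; rewrite -ik => /n_Sn.
Qed.

Lemma subdiv_adj_irrefl : irreflexive subdiv_adj.
Proof.
move=> x; apply/existsP => -[e /existsP[i]]; rewrite orbb => /andP[/eqP-> E].
by move: (subdiv_path_neq e i); rewrite E.
Qed.

Definition subdivision : sgraph := SGraph subdiv_adj_sym subdiv_adj_irrefl.
End Subdivision.

Definition is_hom (H G : sgraph) (f : {ffun H -> G}) : bool :=
  [forall u, forall v, adj u v ==> adj (f u) (f v)].

(* When G has no vertex and H has one, there is no map from H to G and this
   quotient takes the junk value 0. *)
Definition hom_density (R : realType) (H G : sgraph) : R :=
  #|[set f : {ffun H -> G} | is_hom f]|%:R / #|{ffun H -> G}|%:R.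

(* G is assumed nonempty because densities in the empty graph are undefined. *)
Definition sidorenko (R : realType) (H : sgraph) : Prop :=
  bipartite H /\
  forall G : sgraph, (0 < #|G|)%N ->
    hom_density R (complete_graph 2) G ^+ #|edges H| <= hom_density R H G.

Definition dense (R : realType) (rho d : R) (G : sgraph) : Prop :=
  forall X : {set G}, rho * #|G|%:R <= #|X|%:R ->
    d / 2 * #|X|%:R ^+ 2 <= #|edges_in X|%:R.

Definition KNRS (R : realType) (H : sgraph) : Prop :=
  forall d eps : R, 0 < d -> 0 < eps ->
  exists2 rho : R, 0 < rho &
  exists n0 : nat, forall G : sgraph, (n0 <= #|G|)%N -> dense rho d G ->
    (1 - eps) * d ^+ #|edges H| <= hom_density R H G.

Definition weakly_KNRS (R : realType) (H : sgraph) : Prop :=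
  exists2 c : R, 0 < c <= 1 &
  forall d : R, 0 < d ->
  exists2 rho : R, 0 < rho &
  exists n0 : nat, forall G : sgraph, (n0 <= #|G|)%N -> dense rho d G ->
    c * d ^+ #|edges H| <= hom_density R H G.

(* Main.v *)
Require Import Defs.
From mathcomp Require Import all_boot all_order all_algebra.
From mathcomp Require Import reals ring lra zify.

(** Homomorphisms of the [s]-subdivision of [H] into [G] are homomorphisms of
    [H] into the weighted graph whose weights are the numbers of walks of length
    [s + 1] in [G]. By Cauchy-Schwarz (even length), or by local density of [G]
    (odd length), the quadratic form of this kernel is at least [D (sum f)^2] on
    functions [f] supported on a set of vertices starting many walks, and the
    KNRS property transfers from graphs to such kernels: a kernel [W] is realised
    by a graph on [A * F_q^2] in which the points [(a, b)] and [(c, d)] above [x]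
    and [y] are joined iff [ac + b + d] lies among the first [W x y * q] elements
    of [F_q], and this graph is close to [W] in cut norm.

    In a locally dense graph, half of the vertices start the right number of
    walks up to a constant factor, which gives (b). For (a), a dyadic level set
    of the degree inside a subgraph of large minimum degree gives the Sidorenko
    bound up to a factor polynomial in [log |G|], and applying this to tensor
    powers of [G] removes the factor. *)

Set Implicit Arguments.
Unset Strict Implicit.
Unset Printing Implicit Defensive.

Import Order.TTheory GRing.Theory Num.Theory.
Local Open Scope ring_scope.

(** * Sums over vertex maps and weighted homomorphism counts *)

Notation oedge H := {p : H * H | oriented_edge p}.

(** Unnormalised weighted homomorphism count: division by [#|T| ^ #|H|] gives the density. Oriented
    edges make each edge contribute one factor. *)
Definition hom_sum (R : realType) (H : sgraph) (T : finType) (W : T -> T -> R) : R :=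
  \sum_(f : {ffun H -> T}) \prod_(e : oedge H) W (f (val e).1) (f (val e).2).

Section FfunSums.
Variable R : realType.

Definition upd (I T : finType) (f : {ffun I -> T}) (i : I) (t : T) :
  {ffun I -> T} := [ffun j => if j == i then t else f j].

Lemma updE (I T : finType) (f : {ffun I -> T}) i t j :
  upd f i t j = if j == i then t else f j.
Proof. by rewrite ffunE. Qed.

Lemma updC (I T : finType) (f : {ffun I -> T}) i j s t : i != j ->
  upd (upd f i s) j t = upd (upd f j t) i s.
Proof.
move=> ij; apply/ffunP => l; rewrite !updE.
by case: (eqVneq l j) => [->|//]; rewrite eq_sym (negbTE ij).
Qed.

(** The map sending [(f, t)] to [(upd f i t, f i)] is an involution on pairs, so resampling one
    coordinate merely multiplies the sum by [#|T|]. *)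
Lemma sum_upd (I T : finType) (G : {ffun I -> T} -> R) (i : I) :
  \sum_f \sum_t G (upd f i t) = #|T|%:R * \sum_f G f.
Proof.
rewrite (pair_bigA _ (fun f t => G (upd f i t))) /=.
have inj : injective (fun p : {ffun I -> T} * T => (upd p.1 i p.2, p.1 i)).
  move=> [f s] [g t] /= [/ffunP E Ei].
  have Est : s = t by have := E i; rewrite !updE eqxx.
  rewrite Est; congr (_, _); apply/ffunP => j.
  by have := E j; rewrite !updE; case: eqP => [->|].
rewrite -[RHS](_ : \sum_(p : {ffun I -> T} * T) G p.1 = _).
  by rewrite [RHS](reindex_inj inj).
rewrite -(pair_bigA _ (fun f t => G f)) /= mulr_sumr.
by apply: eq_bigr => f _; rewrite sumr_const mulr_natl.
Qed.

Lemma sum_ffun_pair (I A B : finType) (G : {ffun I -> A * B} -> R) :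
  \sum_f G f =
  \sum_(a : {ffun I -> A}) \sum_(b : {ffun I -> B}) G [ffun i => (a i, b i)].
Proof.
rewrite pair_bigA /=.
apply: (reindex (fun p : {ffun I -> A} * {ffun I -> B} =>
  [ffun i => (p.1 i, p.2 i)])).
exists (fun f : {ffun I -> A * B} =>
  ([ffun i => (f i).1], [ffun i => (f i).2])) => /= [[a b] _|f _].
  by congr (_, _); apply/ffunP => i; rewrite !ffunE.
by apply/ffunP => i; rewrite !ffunE /=; case: (f i).
Qed.

Lemma sum_ffun_ordS (T : finType) n (G : {ffun 'I_n.+1 -> T} -> R) :
  \sum_f G f = \sum_t \sum_(g : {ffun 'I_n -> T})
    G [ffun i => if unlift ord0 i is Some j then g j else t].
Proof.
rewrite pair_bigA /=.
apply: (reindex (fun p : T * {ffun 'I_n -> T} =>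
  [ffun i => if unlift ord0 i is Some j then p.2 j else p.1])).
exists (fun f : {ffun 'I_n.+1 -> T} =>
  (f ord0, [ffun i => f (lift ord0 i)])) => /= [[t g] _|f _].
  congr (_, _); first by rewrite ffunE unlift_none.
  by apply/ffunP => i; rewrite !ffunE liftK.
by apply/ffunP => i; rewrite !ffunE /=; case: unliftP => [j|] -> //=; rewrite !ffunE.
Qed.

Lemma sum_ffun_sum (I J T : finType) (G : {ffun I + J -> T} -> R) :
  \sum_f G f = \sum_(a : {ffun I -> T}) \sum_(b : {ffun J -> T})
    G [ffun x => match x with inl i => a i | inr j => b j end].
Proof.
rewrite pair_bigA /=.
apply: (reindex (fun p : {ffun I -> T} * {ffun J -> T} =>
  [ffun x => match x with inl i => p.1 i | inr j => p.2 j end])).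
exists (fun f : {ffun I + J -> T} =>
  ([ffun i => f (inl i)], [ffun j => f (inr j)])) => /= [[a b] _|f _].
  by congr (_, _); apply/ffunP => i; rewrite !ffunE.
by apply/ffunP => -[i|j]; rewrite !ffunE.
Qed.

Lemma sum_ffun_curry (I J T : finType) (G : {ffun I * J -> T} -> R) :
  \sum_f G f = \sum_(a : {ffun I -> {ffun J -> T}}) G [ffun x => a x.1 x.2].
Proof.
apply: (reindex (fun a : {ffun I -> {ffun J -> T}} => [ffun x => a x.1 x.2])).
exists (fun f : {ffun I * J -> T} => [ffun i => [ffun j => f (i, j)]]) => [a _|f _].
  by apply/ffunP => i; apply/ffunP => j; rewrite !ffunE.
by apply/ffunP => -[i j]; rewrite !ffunE.
Qed.

Lemma sum_inj_le (A B : finType) (c : A -> B) (G : B -> R) :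
  injective c -> (forall y, 0 <= G y) -> \sum_x G (c x) <= \sum_y G y.
Proof.
move=> injc G0.
rewrite [leRHS](bigID (mem (c @: setT))) /= big_imset /=; last by move=> ? ? _ _ /injc.
rewrite [X in _ <= X + _](eq_bigl predT) ?lerDl; last by move=> f; rewrite inE.
by apply: sumr_ge0.
Qed.

Lemma sum_comp_inj_le (I A T : finType) (i : A -> T)
    (G : {ffun I -> T} -> R) : injective i -> (forall f, 0 <= G f) ->
  \sum_(f : {ffun I -> A}) G [ffun h => i (f h)] <= \sum_f G f.
Proof.
move=> inji; apply: (sum_inj_le (c := fun f : {ffun I -> A} => [ffun h => i (f h)])).
move=> f g /ffunP E; apply/ffunP => h; apply: inji.
by have := E h; rewrite !ffunE.
Qed.

(** Multiplicativity over tensor products serves twice: to remove the fibre [F * F] of the blow-up,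
    and to square densities in the tensor power argument. *)
Lemma hom_sum_pair (H : sgraph) (A B : finType) (U : A -> A -> R)
    (V : B -> B -> R) :
  hom_sum H (fun p q : A * B => U p.1 q.1 * V p.2 q.2) =
  hom_sum H U * hom_sum H V.
Proof.
rewrite /hom_sum sum_ffun_pair mulr_suml; apply: eq_bigr => a _.
rewrite mulr_sumr; apply: eq_bigr => b _; rewrite -big_split /=.
by apply: eq_bigr => e _; rewrite !ffunE.
Qed.

Lemma hom_sum1 (H : sgraph) (B : finType) :
  hom_sum H (fun _ _ : B => 1 : R) = #|B|%:R ^+ #|H|.
Proof.
rewrite /hom_sum (eq_bigr (fun=> 1)); last by move=> f _; rewrite big1.
by rewrite sumr_const card_ffun natrX.
Qed.

End FfunSums.

(** * Cauchy-Schwarz and the counting lemma for the cut norm *)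

Section Cauchy.
Variable R : realType.

(** Lagrange's identity: the double sum of the squares of [a i * b j - a j * b i] is twice the
    difference of the two sides. *)
Lemma cauchy_schwarz_sum (I : finType) (a b : I -> R) :
  (\sum_i a i * b i) ^+ 2 <= (\sum_i a i ^+ 2) * (\sum_i b i ^+ 2).
Proof.
have : 0 <= \sum_i \sum_j (a i * b j - a j * b i) ^+ 2.
  by apply: sumr_ge0 => i _; apply: sumr_ge0 => j _; apply: sqr_ge0.
rewrite (eq_bigr (fun i => \sum_j (a i ^+ 2 * b j ^+ 2) +
  \sum_j (a j ^+ 2 * b i ^+ 2) - (\sum_j (a i * b i) * (a j * b j)) *+ 2)).
  rewrite big_split big_split /= sumrN sumrMnl.
  rewrite [X in _ + X - _]exchange_big /= -!big_distrlr /= -expr2; lra.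
move=> i _; rewrite -sumrMnl -big_split -sumrB /=.
by apply: eq_bigr => j _; ring.
Qed.

End Cauchy.

Section Counting.
Variable R : realType.

Definition unit_fun (T : Type) (f : T -> R) := forall x, 0 <= f x <= 1.

(** Cut-norm distance, tested against weights in [0, 1] rather than sets, because the remaining
    factors of a homomorphism product are such weights. *)
Definition cut_close (T : finType) (eta : R) (K W : T -> T -> R) :=
  forall f g : T -> R, unit_fun f -> unit_fun g ->
  `|\sum_x \sum_y f x * g y * (K x y - W x y)| <= eta * #|T|%:R ^+ 2.

Lemma unit_prod (I : finType) (P : pred I) (F : I -> R) :
  (forall i, 0 <= F i <= 1) -> 0 <= \prod_(i | P i) F i <= 1.
Proof.
move=> F01; elim/big_ind : _ => [|x y /andP[x0 x1] /andP[y0 y1]|i _ //].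
  by rewrite ler01 lexx.
by rewrite mulr_ge0 // mulr_ile1.
Qed.

(** Resampling the values at [u] and [v] isolates a double sum over these two values in which [f]
    depends only on the first and [g] only on the second; the cut norm bounds it for each choice of
    the other coordinates. *)
Lemma cut_close_step (I T : finType) eta (K W : T -> T -> R) (u v : I)
    (f g : {ffun I -> T} -> R) :
  (0 < #|T|)%N -> cut_close eta K W -> u != v -> unit_fun f -> unit_fun g ->
  (forall h t, f (upd h v t) = f h) -> (forall h t, g (upd h u t) = g h) ->
  `|\sum_h f h * g h * (K (h u) (h v) - W (h u) (h v))| <=
    eta * #|T|%:R ^+ #|I|.
Proof.
move=> T0 cKW uv f01 g01 fv gu; set S := \sum_h _.
have E : #|T|%:R ^+ 2 * S = \sum_h \sum_x \sum_y f (upd h u x) * g (upd h v y) *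
    (K x y - W x y).
  rewrite expr2 -mulrA -(sum_upd _ v) -(sum_upd _ u).
  apply: eq_bigr => h _; apply: eq_bigr => x _; apply: eq_bigr => y _.
  by rewrite fv updC // gu !updE !eqxx (eq_sym v) (negbTE uv).
have n0 : 0 < #|T|%:R ^+ 2 :> R by rewrite exprn_gt0 ?ltr0n.
rewrite -(ler_pM2l n0) -{1}(gtr0_norm n0) -normrM E.
apply: le_trans (ler_norm_sum _ _ _) _.
rewrite mulrCA mulrA -(natrX _ _ #|I|) -card_ffun.
apply: le_trans (_ : \sum_(h : {ffun I -> T}) eta * #|T|%:R ^+ 2 <= _).
  by apply: ler_sum => h _; apply: cKW => x.
by rewrite sumr_const mulr_natr.
Qed.

Lemma oedge_neq (H : sgraph) (e : oedge H) : (val e).1 != (val e).2.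
Proof.
case: e => -[u v] /= /andP[/= uv _]; apply/eqP => E.
by rewrite E adj_irrefl in uv.
Qed.

(** Both orientations increase [enum_rank], which excludes loops and reversed pairs. Hence an edge
    other than the current one avoids at least one of its ends. *)
Lemma oedge_ends_inj (H : sgraph) (e e' : oedge H) :
  ((val e).1 == (val e').1) || ((val e).2 == (val e').1) ->
  ((val e).1 == (val e').2) || ((val e).2 == (val e').2) -> e = e'.
Proof.
move=> h1 h2; apply: val_inj; move: h1 h2.
case: e e' => -[u v] /= /andP[/= _ uv] [[u' v'] /= /andP[/= _ uv']].
move=> /orP[] /eqP E1 /orP[] /eqP E2; subst => //.
- by rewrite ltnn in uv'.
- by have := ltn_trans uv uv'; rewrite ltnn.
- by rewrite ltnn in uv'.
Qed.

(** Telescoping: [W] is replaced by [K] one edge at a time, and each replacement costs at most one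
    cut-norm error. *)
Lemma counting_lemma (H : sgraph) (T : finType) eta (K W : T -> T -> R) :
  (0 < #|T|)%N -> (forall x y, 0 <= K x y <= 1) ->
  (forall x y, 0 <= W x y <= 1) -> cut_close eta K W ->
  `|hom_sum H K - hom_sum H W| <=
    #|{: oedge H}|%:R * (eta * #|T|%:R ^+ #|H|).
Proof.
move=> T0 K01 W01 cKW.
pose L j (e : oedge H) := if (enum_rank e < j)%N then K else W.
pose S j := \sum_(f : {ffun H -> T}) \prod_(e : oedge H)
  L j e (f (val e).1) (f (val e).2).
have L01 j e x y : 0 <= L j e x y <= 1 by rewrite /L; case: ifP.
have -> : hom_sum H W = S 0%N by [].
have -> : hom_sum H K = S #|{: oedge H}|.
  apply: eq_bigr => f _; apply: eq_bigr => e _.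
  by rewrite /L ltn_ord.
suff SP j : (j <= #|{: oedge H}|)%N ->
    `|S j - S 0%N| <= j%:R * (eta * #|T|%:R ^+ #|H|) by exact: SP.
elim: j => [|j IHj] jm; first by rewrite subrr normr0 mul0r.
have -> : S j.+1 - S 0%N = (S j.+1 - S j) + (S j - S 0%N) by ring.
apply: le_trans (ler_normD _ _) _.
rewrite -natr1 mulrDl mul1r addrC lerD ?IHj ?(ltnW jm) //.
pose e0 := enum_val (Ordinal jm).
have e0E : enum_rank e0 = Ordinal jm by rewrite enum_valK.
pose P (h : {ffun H -> T}) (Q : pred (oedge H)) :=
  \prod_(e | (e != e0) && Q e) L j e (h (val e).1) (h (val e).2).
(* The other edges are split into those through the second end of [e0] and the rest. The former
   avoid the first end, the latter the second, so the two products meet the independence conditions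
   of [cut_close_step]. *)
pose Q (e : oedge H) := ((val e).1 == (val e0).2) || ((val e).2 == (val e0).2).
have -> : S j.+1 - S j = \sum_h P h (predC Q) * P h Q *
    (K (h (val e0).1) (h (val e0).2) - W (h (val e0).1) (h (val e0).2)).
  rewrite -sumrB; apply: eq_bigr => h _.
  rewrite (bigD1 e0) //= [X in _ - X](bigD1 e0) //= /L e0E /= ltnn leqnn.
  rewrite (eq_bigr (fun e => L j e (h (val e).1) (h (val e).2))); last first.
    move=> e ne; rewrite /L ltnS leq_eqVlt; case: eqP => //= E.
    by case/eqP: ne; apply: enum_rank_inj; apply: val_inj; rewrite e0E.
  rewrite -mulrBl (bigID Q) /= /P /=; ring.
apply: cut_close_step => //; first exact: oedge_neq.
- by move=> h; apply: unit_prod.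
- by move=> h; apply: unit_prod.
- move=> h t; apply: eq_bigr => e /andP[_ /norP[n1 n2]].
  by rewrite !updE (negbTE n1) (negbTE n2).
- move=> h t; apply: eq_bigr => e /andP[ne Qe].
  have /norP[n1 n2] : ~~ (((val e).1 == (val e0).1) || ((val e).2 == (val e0).1)).
    by apply/negP => h1; case/eqP: ne; apply: oedge_ends_inj.
  by rewrite !updE (negbTE n1) (negbTE n2).
Qed.

End Counting.

(** * A pseudorandom bilinear pattern over a finite field *)

Section AffineDesign.
Variables (R : realType) (F : finFieldType).
Local Notation q := (#|F|%:R : R).

Definition line_val (u v : F * F) : F := u.1 * v.1 + u.2 + v.2.

Lemma line_valC u v : line_val u v = line_val v u.
Proof. rewrite /line_val; ring. Qed.

(** When the first coordinates of [u] and [u'] differ, [v] is determined by its two values, so these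
    values run over all pairs in [F * F] exactly once. *)
Lemma sum_line_val (h : F -> R) (u u' : F * F) : u.1 != u'.1 ->
  \sum_v h (line_val u v) * h (line_val u' v) = (\sum_t h t) ^+ 2.
Proof.
move=> uu'.
have inj : injective (fun v => (line_val u v, line_val u' v)).
  move=> [a b] [a' b'] /= []; rewrite /line_val /= => E E'.
  have : (u.1 - u'.1) * (a - a') = 0.
    have : (u.1 * a + u.2 + b) - (u'.1 * a + u'.2 + b) =
           (u.1 * a' + u.2 + b') - (u'.1 * a' + u'.2 + b') by rewrite E E'.
    by move/eqP; rewrite -subr_eq0 => /eqP <-; ring.
  move/eqP; rewrite mulf_eq0 !subr_eq0 (negbTE uu') /= => /eqP Ea.
  by move: E; rewrite Ea => /addrI ->.
rewrite expr2 big_distrlr /= pair_bigA /=.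
by rewrite [RHS](reindex_inj inj).
Qed.

(* Values at points with distinct first coordinates are pairwise independent,
   so after Cauchy-Schwarz only pairs sharing it contribute more than [O(1)]. *)
Lemma line_val_cut (h : F -> R) (f g : F * F -> R) :
  (forall t, `|h t| <= 1) -> `|\sum_t h t| <= 1 ->
  unit_fun f -> unit_fun g ->
  (\sum_u \sum_v f u * g v * h (line_val u v)) ^+ 2 <= 2 * q ^+ 7.
Proof.
move=> h1 hs f01 g01.
have q1 : 1 <= q by rewrite ler1n; apply/card_gt0P; exists 0.
have cFF : #|{: F * F}|%:R = q ^+ 2 by rewrite card_prod natrM expr2.
rewrite exchange_big /=.
rewrite (eq_bigr (fun v => g v * \sum_u f u * h (line_val u v))); last first.
  by move=> v _; rewrite mulr_sumr; apply: eq_bigr => u _; ring.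
apply: le_trans (cauchy_schwarz_sum _ _) _.
have g2 : \sum_v g v ^+ 2 <= q ^+ 2.
  rewrite -cFF -sumr_const; apply: ler_sum => v _.
  by rewrite exprn_ile1; have /andP[] := g01 v.
have h2 : \sum_v (\sum_u f u * h (line_val u v)) ^+ 2 <= 2 * q ^+ 5.
  apply: (@le_trans _ _ (\sum_u \sum_u' `|\sum_v h (line_val u v) * h (line_val u' v)|)).
    rewrite (eq_bigr (fun v => \sum_u \sum_u' (f u * f u') *
      (h (line_val u v) * h (line_val u' v)))); last first.
      move=> v _; rewrite expr2 big_distrlr /=.
      by apply: eq_bigr => u _; apply: eq_bigr => u' _; ring.
    rewrite exchange_big /=; apply: ler_sum => u _.
    rewrite exchange_big /=; apply: ler_sum => u' _.
    rewrite -mulr_sumr; apply: le_trans (ler_norm _) _; rewrite normrM.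
    have /andP[a0 a1] := f01 u; have /andP[b0 b1] := f01 u'.
    by rewrite ler_piMl // ger0_norm ?mulr_ge0 // mulr_ile1.
  have bnd (u u' : F * F) : `|\sum_v h (line_val u v) * h (line_val u' v)| <=
      1 + (u'.1 == u.1)%:R * q ^+ 2.
    case: (eqVneq u.1 u'.1) => [E|ne].
      rewrite mul1r; apply: le_trans (ler_norm_sum _ _ _) _.
      apply: (@le_trans _ _ (q ^+ 2)); last by rewrite lerDr.
      rewrite -cFF -sumr_const; apply: ler_sum => v _.
      by rewrite normrM mulr_ile1.
    by rewrite sum_line_val // mul0r addr0 normrX exprn_ile1.
  have step u : \sum_u' `|\sum_v h (line_val u v) * h (line_val u' v)| <= 2 * q ^+ 3.
    apply: (@le_trans _ _ (\sum_(u' : F * F) (1 + (u'.1 == u.1)%:R * q ^+ 2))).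
      by apply: ler_sum => u' _; apply: bnd.
    rewrite big_split /= sumr_const cFF -mulr_suml.
    have -> : \sum_(u' : F * F) (u'.1 == u.1)%:R = q.
      rewrite -(pair_bigA _ (fun a b => (a == u.1)%:R)) /= (bigD1 u.1) //=.
      rewrite [X in _ + X]big1 ?addr0; last first.
        by move=> a /negbTE na; rewrite big1 // => b _; rewrite na.
      by rewrite eqxx sumr_const.
    have := ler_wpM2r (exprn_ge0 2 (le_trans ler01 q1)) q1.
    by rewrite mul1r -exprS; lra.
  apply: le_trans (ler_sum _ (fun u _ => step u)) _.
  by rewrite sumr_const -[leLHS]mulr_natl cFF; rewrite le_eqVlt; apply/orP; left; apply/eqP; ring.
apply: le_trans (ler_pM _ _ g2 h2) _.
- by apply: sumr_ge0 => v _; apply: sqr_ge0.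
- by apply: sumr_ge0 => v _; apply: sqr_ge0.
by rewrite le_eqVlt; apply/orP; left; apply/eqP; ring.
Qed.

Definition threshold (w : R) (t : F) : bool :=
  (enum_rank t < Num.truncn (w * q))%N.

(** The sum is [truncn (w * q) - w * q], a single rounding error. *)
Lemma sum_threshold w : 0 <= w <= 1 ->
  `|\sum_(t : F) ((threshold w t)%:R - w)| <= 1.
Proof.
move=> /andP[w0 w1].
have q0 : 0 <= q by [].
have wq0 : 0 <= w * q by rewrite mulr_ge0.
have /andP[t1 t2] := truncn_itv wq0.
set m := Num.truncn _ in t1 t2 *.
have mq : (m <= #|F|)%N.
  by rewrite -(ler_nat R); apply: le_trans t1 _; rewrite ler_piMl.
rewrite sumrB sumr_const -mulr_natr.
have -> : \sum_(t : F) (threshold w t)%:R = m%:R :> R.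
  rewrite (reindex_onto enum_val enum_rank) /=; last by move=> i _; rewrite enum_rankK.
  rewrite (eq_big predT (fun i : 'I_#|F| => (i < m)%N%:R)); last 2 first.
  - by move=> i; rewrite enum_valK eqxx.
  - by move=> i _; rewrite /threshold enum_valK.
  have <- : \sum_(i < m) 1 = m%:R :> R by rewrite sumr_const card_ord.
  rewrite (big_ord_widen _ (fun=> 1) mq) [RHS]big_mkcond /=.
  by apply: eq_bigr => i _; case: ltnP.
rewrite ler_norml; move: t2; rewrite -natr1; lra.
Qed.
End AffineDesign.

(** * Edge counts and homomorphism densities as sums of adjacency weights *)

Section EdgeCounts.
Variable G : sgraph.

Lemma set2_oriented_inj :
  {in oriented_edge (H := G) &, injective (fun p : G * G => [set p.1; p.2])}.
Proof.
move=> [u v] [u' v'] /andP[/= _ uv] /andP[/= _ uv'] /= E.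
have : u \in [set u'; v'] by rewrite -E !inE eqxx.
have : v \in [set u'; v'] by rewrite -E !inE eqxx orbT.
rewrite !inE => /orP[] /eqP E2 /orP[] /eqP E1; subst => //.
- by rewrite ltnn in uv.
- by have := ltn_trans uv uv'; rewrite ltnn.
- by rewrite ltnn in uv.
Qed.

Lemma edges_in_oriented (X : {set G}) :
  edges_in X = [set [set p.1; p.2] | p in
    [set p : G * G | oriented_edge p && ((p.1 \in X) && (p.2 \in X))]].
Proof.
apply/setP => E; rewrite inE; apply/andP/imsetP.
  case=> /imsetP[[u v]]; rewrite inE /= => uv -> /subsetP sX.
  have uX : u \in X by apply: sX; rewrite !inE eqxx.
  have vX : v \in X by apply: sX; rewrite !inE eqxx orbT.
  have [lt|lt|eq] := ltngtP (enum_rank u) (enum_rank v).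
  - by exists (u, v); rewrite // inE /oriented_edge /= uv lt uX.
  - exists (v, u); last by rewrite /= setUC.
    by rewrite inE /oriented_edge /= adj_sym uv lt vX.
  - have E' : u = v by apply: enum_rank_inj; apply: val_inj.
    by rewrite E' adj_irrefl in uv.
case=> -[u v]; rewrite inE /= => /andP[/andP[/= uv _] /andP[uX vX]] ->; split.
  by apply/imsetP; exists (u, v); rewrite ?inE.
by apply/subsetP => x; rewrite !inE => /orP[] /eqP ->.
Qed.

Lemma card_edges_in (X : {set G}) : #|edges_in X| =
  #|[set p : G * G | oriented_edge p && ((p.1 \in X) && (p.2 \in X))]|.
Proof.
rewrite edges_in_oriented card_in_imset // => p p'.
by rewrite !inE => /andP[op _] /andP[op' _]; apply: set2_oriented_inj.
Qed.

Lemma card_edges : #|edges G| = #|{: oedge G}|.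
Proof.
have -> : edges G = edges_in [set: G].
  by apply/setP => e; rewrite inE subsetT andbT.
rewrite card_edges_in card_sig; apply: eq_card => p.
by rewrite !inE ?andbT.
Qed.

(** Each edge inside [X] comes from two ordered pairs, an oriented one and its reverse. *)
Lemma sum_adj (R : realType) (X : {set G}) :
  \sum_(x in X) \sum_(y in X) (adj x y)%:R = 2 * #|edges_in X|%:R :> R.
Proof.
pose O (p : G * G) := (oriented_edge p && ((p.1 \in X) && (p.2 \in X)))%:R : R.
have OE : \sum_p O p = #|edges_in X|%:R.
  rewrite card_edges_in -sum1_card natr_sum big_mkcond /=.
  rewrite [RHS]big_mkcond /=; apply: eq_bigr => p _; rewrite inE /O.
  by case: (_ && _).
have OE' : \sum_p O (p.2, p.1) = #|edges_in X|%:R.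
  rewrite -OE [RHS](reindex_inj (h := fun p => (p.2, p.1))) //.
  by move=> [a b] [c d] /= [-> ->].
rewrite pair_big /= mulrDl !mul1r -{1}OE -OE' -big_split /= big_mkcond /=.
apply: eq_bigr => -[x y] _; rewrite /O /oriented_edge /= (adj_sym y) (andbC (y \in X)).
case: (_ && _); rewrite ?andbF ?addr0 // !andbT.
have [lt|lt|eq] := ltngtP (enum_rank x) (enum_rank y); rewrite ?andbT ?andbF ?addr0 ?add0r //.
have -> : x = y by apply: enum_rank_inj; apply: val_inj.
by rewrite adj_irrefl.
Qed.

End EdgeCounts.

Section HomCount.
Variables (R : realType) (H G : sgraph).

Definition adjr (x y : G) : R := (adj x y)%:R.

Lemma is_homP (f : {ffun H -> G}) :
  is_hom f = [forall e : oedge H, adj (f (val e).1) (f (val e).2)].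
Proof.
apply/forallP/forallP => [hf [[u v] /= /andP[/= uv o]]|hf u].
  by have /forallP/(_ v)/implyP := hf u; apply.
apply/forallP => v; apply/implyP => uv.
have [lt|lt|eq] := ltngtP (enum_rank u) (enum_rank v).
- have o : oriented_edge (u, v) by rewrite /oriented_edge /= uv.
  exact: (hf (exist _ (u, v) o)).
- have o : oriented_edge (v, u) by rewrite /oriented_edge /= adj_sym uv.
  by rewrite adj_sym; exact: (hf (exist _ (v, u) o)).
- have E : u = v by apply: enum_rank_inj; apply: val_inj.
  by rewrite E adj_irrefl in uv.
Qed.

Lemma hom_densityE :
  hom_density R H G = hom_sum H adjr / #|G|%:R ^+ #|H|.
Proof.
rewrite /hom_density card_ffun natrX; congr (_ / _).
rewrite -sum1_card natr_sum big_mkcond /=; apply: eq_bigr => f _.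
rewrite inE is_homP; case: forallP => [hf|/forallP].
  by rewrite big1 // => e _; rewrite /adjr hf.
rewrite negb_forall => /existsP[e ne].
by rewrite (bigD1 e) //= /adjr (negbTE ne) mul0r.
Qed.

End HomCount.

(** * Realising a kernel by a graph, and the KNRS property for kernels *)

Section Blowup.
Variables (R : realType) (A : finType) (F : finFieldType) (W : A -> A -> R).
Hypothesis Wsym : forall x y, W x y = W y x.
Hypothesis W01 : forall x y, 0 <= W x y <= 1.
Local Notation q := (#|F|%:R : R).
Local Notation V := (A * (F * F))%type.

Definition blowup_adj : rel V := fun p p' =>
  (p != p') && threshold (W p.1 p'.1) (line_val p.2 p'.2).

Lemma blowup_adj_sym : symmetric blowup_adj.
Proof. by move=> p p'; rewrite /blowup_adj eq_sym Wsym line_valC. Qed.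

Lemma blowup_adj_irrefl : irreflexive blowup_adj.
Proof. by move=> p; rewrite /blowup_adj eqxx. Qed.

Definition blowup : sgraph := SGraph blowup_adj_sym blowup_adj_irrefl.

Lemma card_blowup : #|{: V}|%:R = #|A|%:R * q ^+ 2.
Proof. by rewrite !card_prod !natrM expr2. Qed.

(** The form splits into blocks, one for each pair of base points. In a block [line_val_cut] bounds
    the square by [2 * q ^ 7], which is at most [(eta * q ^ 4) ^ 2]. The second [eta] pays for the
    deleted diagonal. The factor [* 1] puts the limit kernel in the product form of
    [hom_sum_pair]. *)
Lemma cut_close_blowup (eta : R) : (0 < #|A|)%N -> 0 < eta -> 1 <= eta * q ->
  2 <= eta ^+ 2 * q ->
  cut_close (T := V) (2 * eta) (fun p p' => (blowup_adj p p')%:R)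
    (fun p p' => W p.1 p'.1 * 1).
Proof.
move=> A0 eta0 q1 q2 f g f01 g01.
have qge0 : 0 <= q by [].
pose thr (p p' : V) : R := (threshold (W p.1 p'.1) (line_val p.2 p'.2))%:R.
have -> : \sum_x \sum_y f x * g y * ((blowup_adj x y)%:R - W x.1 y.1 * 1) =
  \sum_x \sum_y f x * g y * (thr x y - W x.1 y.1) - \sum_x f x * g x * thr x x.
  rewrite -sumrB; apply: eq_bigr => x _.
  rewrite (bigD1 x) //= [in RHS](bigD1 x) //=.
  rewrite blowup_adj_irrefl mulr1.
  rewrite (eq_bigr (fun y => f x * g y * (thr x y - W x.1 y.1))); last first.
    by move=> y nyx; rewrite /blowup_adj eq_sym nyx mulr1.
  set S := \sum_(_ | _) _.
  by rewrite (_ : false%:R = 0) //; ring.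
apply: le_trans (ler_normB _ _) _.
(* The diagonal contributes at most one per point, and [1 <= eta * q] with at least [q] points makes
   this at most [eta] times the square of their number. *)
have N1 : `|\sum_x f x * g x * thr x x| <= eta * #|{: V}|%:R ^+ 2.
  apply: le_trans (ler_norm_sum _ _ _) _.
  apply: (@le_trans _ _ (\sum_(x : V) 1)).
    apply: ler_sum => x _; have /andP[a0 a1] := f01 x; have /andP[b0 b1] := g01 x.
    rewrite ger0_norm ?mulr_ge0 // ?ler0n //.
    by rewrite !mulr_ile1 ?mulr_ge0 ?ler0n // /thr; case: threshold.
  rewrite sumr_const expr2 mulrA ler_peMl ?ler0n //.
  apply: le_trans q1 _; rewrite ler_pM2l // ler_nat !card_prod mulnA.
  rewrite leq_pmull // muln_gt0 A0; apply/card_gt0P; by exists 0.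
suff N2 : `|\sum_x \sum_y f x * g y * (thr x y - W x.1 y.1)| <=
    eta * #|{: V}|%:R ^+ 2.
  by apply: le_trans (lerD N2 N1) _; rewrite -mulrA [leRHS]mulr_natl mulr2n lexx.
have -> : \sum_x \sum_y f x * g y * (thr x y - W x.1 y.1) =
    \sum_x \sum_y \sum_u \sum_v f (x, u) * g (y, v) *
      (thr (x, u) (y, v) - W x y).
  rewrite [RHS](eq_bigr (fun x => \sum_u \sum_y \sum_v f (x, u) * g (y, v) *
      (thr (x, u) (y, v) - W x y))); last by move=> x _; rewrite exchange_big.
  rewrite [RHS]pair_bigA /=; apply: eq_bigr => -[x u] _.
  by rewrite [RHS]pair_bigA /=; apply: eq_bigr => -[y v] _.
have B x y : `|\sum_u \sum_v f (x, u) * g (y, v) * (thr (x, u) (y, v) - W x y)|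
    <= eta * q ^+ 4.
  pose h (t : F) : R := (threshold (W x y) t)%:R - W x y.
  have e4 : 0 <= eta * q ^+ 4 by rewrite mulr_ge0 ?exprn_ge0 // ltW.
  rewrite -(ler_pXn2r (n := 2)) ?nnegrE // -normrX ger0_norm ?sqr_ge0 //.
  apply: (@le_trans _ _ (2 * q ^+ 7)); first apply: (@line_val_cut R F h
    (fun u => f (x, u)) (fun v => g (y, v))).
  - move=> t; have /andP[a0 a1] := W01 x y.
    by rewrite ler_norml /h; case: threshold => /=; lra.
  - exact: sum_threshold.
  - by move=> u.
  - by move=> v.
  - have := ler_wpM2r (exprn_ge0 7 qge0) q2.
    have -> : (eta * q ^+ 4) ^+ 2 = eta ^+ 2 * q * q ^+ 7 by ring.
    by [].
apply: le_trans (ler_norm_sum _ _ _) _.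
apply: (@le_trans _ _ (\sum_(x : A) \sum_(y : A) eta * q ^+ 4)).
  apply: ler_sum => x _; apply: le_trans (ler_norm_sum _ _ _) _.
  by apply: ler_sum => y _; exact: B.
rewrite !sumr_const card_blowup -mulrnA -[leLHS]mulr_natl natrM.
by rewrite le_eqVlt; apply/orP; left; apply/eqP; ring.
Qed.

End Blowup.

(** Weighted counterpart of [dense]: ordered pairs replace edges, hence there is no factor 1/2. *)
Definition kernel_dense (R : realType) (A : finType) (rho D : R)
    (W : A -> A -> R) :=
  forall f : A -> R, unit_fun f -> rho * #|A|%:R <= \sum_x f x ->
  D * (\sum_x f x) ^+ 2 <= \sum_x \sum_y f x * f y * W x y.

(** The share of each fibre that lies in [X] is a weight in [0, 1] on the base, and its form is that
    of [X] divided by [q ^ 4]. *)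
Lemma kernel_dense_blowup (R : realType) (A : finType) (F : finFieldType)
    (W : A -> A -> R) (rho D : R) (X : {set A * (F * F)}) :
  kernel_dense rho D W -> rho * #|{: A * (F * F)}|%:R <= #|X|%:R ->
  D * #|X|%:R ^+ 2 <= \sum_(p in X) \sum_(p' in X) W p.1 p'.1.
Proof.
move=> dW hX.
have q0 : 0 < #|F|%:R ^+ 2 :> R.
  by rewrite exprn_gt0 // ltr0n; apply/card_gt0P; exists 0.
pose I p : R := (p \in X)%:R.
pose m x : R := \sum_u I (x, u).
have IS (G : A * (F * F) -> R) : \sum_(p in X) G p = \sum_x \sum_u I (x, u) * G (x, u).
  rewrite pair_bigA /= big_mkcond /=; apply: eq_bigr => -[x u] _.
  by rewrite /I /=; case: (_ \in _); rewrite ?mul1r ?mul0r.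
have mX : \sum_x m x = #|X|%:R.
  rewrite -sum1_card natr_sum IS; apply: eq_bigr => x _; apply: eq_bigr => u _.
  by rewrite mulr1.
have m01 : unit_fun (fun x => m x / #|F|%:R ^+ 2).
  move=> x; have m0 : 0 <= m x by apply: sumr_ge0 => u _; apply: ler0n.
  rewrite divr_ge0 ?(ltW q0) //=.
  rewrite ler_pdivrMr // mul1r.
  have -> : #|F|%:R ^+ 2 = \sum_(u : F * F) 1 :> R.
    by rewrite sumr_const card_prod natrM expr2.
  by apply: ler_sum => u _; rewrite /I; case: (_ \in _).
have h := dW _ m01; rewrite -!mulr_suml mX ler_pdivlMr // in h.
have E : \sum_(p in X) \sum_(p' in X) W p.1 p'.1 = \sum_x \sum_y m x * m y * W x y.
  rewrite IS; apply: eq_bigr => x _ /=; rewrite -mulr_suml.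
  rewrite IS /= mulr_sumr; apply: eq_bigr => y _.
  by rewrite -mulr_suml mulrA.
rewrite E.
have {}h : D * (#|X|%:R / #|F|%:R ^+ 2) ^+ 2 <=
   (\sum_x \sum_y m x * m y * W x y) / (#|F|%:R ^+ 2) ^+ 2.
  apply: le_trans (h _) _.
    by move: hX; rewrite !card_prod !natrM expr2 !mulrA.
  rewrite le_eqVlt; apply/orP; left; apply/eqP.
  rewrite mulr_suml; apply: eq_bigr => x _; rewrite mulr_suml; apply: eq_bigr => y _.
  by field; rewrite lt0r_neq0 // ltr0n; apply/card_gt0P; exists 0.
have q2 : 0 < (#|F|%:R ^+ 2) ^+ 2 :> R by rewrite exprn_gt0.
move: h; rewrite (expr_div_n #|X|%:R) mulrA ler_pM2r ?invr_gt0 //.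
Qed.

Lemma bernoulli_sub (R : realType) (x : R) n : 0 <= x <= 1 ->
  1 - n%:R * x <= (1 - x) ^+ n.
Proof.
move=> /andP[x0 x1]; elim: n => [|n IH]; first by rewrite mul0r subr0.
rewrite exprS; apply: le_trans (ler_wpM2l _ IH); last by lra.
have : 0 <= n%:R * x * x by rewrite !mulr_ge0.
rewrite -natr1; nra.
Qed.

Lemma prime_field_large (R : realType) (x y : R) (n0 : nat) :
  exists F : finFieldType, [/\ (n0 <= #|F|)%N, x <= #|F|%:R & y <= #|F|%:R].
Proof.
have [p pN pp] := prime_above (n0 + (Num.truncn x).+1 + (Num.truncn y).+1).
exists 'F_p; rewrite card_Fp //; split.
- by apply: ltnW; apply: leq_ltn_trans pN; rewrite -addnA leq_addr.
- apply: le_trans (ltW (truncnS_gt x)) _; rewrite ler_nat.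
  by apply: ltnW; apply: leq_ltn_trans pN; rewrite -addnA addnCA leq_addr.
- apply: le_trans (ltW (truncnS_gt y)) _; rewrite ler_nat.
  by apply: ltnW; apply: leq_ltn_trans pN; rewrite leq_addl.
Qed.

(** The KNRS property is applied to the blow-up: cut closeness makes it locally dense with a
    slightly smaller constant, and the counting lemma carries its homomorphism count back to [W].
    The base may have any positive size, since a large field brings the blow-up above [n0]. *)
Lemma KNRS_kernel (R : realType) (H : sgraph) (D eps : R) :
  KNRS R H -> 0 < D -> 0 < eps <= 1 ->
  exists2 rho : R, 0 < rho &
  forall (A : finType) (W : A -> A -> R), (0 < #|A|)%N ->
    (forall x y, W x y = W y x) -> (forall x y, 0 <= W x y <= 1) ->
    kernel_dense rho D W ->
    (1 - eps) * D ^+ #|{: oedge H}| * #|A|%:R ^+ #|H| <= hom_sum H W.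
Proof.
set m := #|{: oedge H}| => hH D0 /andP[eps0 eps1].
have [m1 m1E] : {x : R | x = m.+1%:R} by exists m.+1%:R.
have m10 : 0 < m1 by rewrite m1E ltr0n.
have m1ge1 : 1 <= m1 by rewrite m1E ler1n.
(* The loss [1 - del] occurs [m + 1] times, once for each edge and once in the KNRS bound; by
   Bernoulli it totals at most [eps / 2]. The other half pays for the counting lemma. *)
pose del := eps / (2 * m1).
have del0 : 0 < del by rewrite divr_gt0 // mulr_gt0.
have delE : m1 * del = eps / 2 by rewrite /del; field; rewrite lt0r_neq0.
have del1 : del <= 1 / 2 by nra.
have d0 : 0 < (1 - del) * D by rewrite mulr_gt0 //; lra.
have [rho rho0 [n0 hG]] := hH _ _ d0 del0.
exists rho => // A W A0 Wsym W01 dW.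
(* The first bound keeps the blow-up [(1 - del) * D]-dense on sets of relative size at least [rho];
   the second keeps the counting error [m * (2 * eta)] below [eps / 2 * D ^ m]. *)
pose eta := Num.min (del * D * rho ^+ 2 / 2) (eps * D ^+ m / (4 * m1)).
have eta0 : 0 < eta.
  rewrite lt_min; apply/andP; split.
    by rewrite divr_gt0 // mulr_gt0 ?exprn_gt0 // mulr_gt0.
  by apply: divr_gt0; rewrite mulr_gt0 ?exprn_gt0.
have eta1 : eta <= del * D * rho ^+ 2 / 2 by rewrite ge_min lexx.
have eta2 : eta <= eps * D ^+ m / (4 * m1) by rewrite ge_min lexx orbT.
have [F [Fn0 F1 F2]] := prime_field_large (1 / eta) (2 / eta ^+ 2) n0.
have q1 : 1 <= eta * #|F|%:R by rewrite mulrC -ler_pdivrMr.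
have q2 : 2 <= eta ^+ 2 * #|F|%:R by rewrite mulrC -ler_pdivrMr // exprn_gt0.
have cut := @cut_close_blowup R A F W W01 eta A0 eta0 q1 q2.
pose V := (A * (F * F))%type.
have F0 : (0 < #|F|)%N by apply/card_gt0P; exists 0.
have V0 : (0 < #|{: V}|)%N by rewrite !card_prod !muln_gt0 A0 F0.
have VA : (#|F| <= #|{: V}|)%N.
  by rewrite !card_prod mulnA leq_pmull // muln_gt0 A0.
pose Gam := blowup F Wsym.
have dGam : dense rho ((1 - del) * D) Gam.
  move=> X hX.
  have hX' : rho * #|{: V}|%:R <= #|X|%:R := hX.
  have := kernel_dense_blowup dW hX' => lo.
  have /cut cX : unit_fun (fun p : V => (p \in X)%:R : R).
    by move=> p; case: (p \in X); rewrite ?lexx ?ler01.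
  have /cX {}cX : unit_fun (fun p : V => (p \in X)%:R : R).
    by move=> p; case: (p \in X); rewrite ?lexx ?ler01.
  have E : 2 * #|edges_in (G := Gam) X|%:R - \sum_(p in X) \sum_(p' in X) W p.1 p'.1 =
    \sum_(x : V) \sum_(y : V) (x \in X)%:R * (y \in X)%:R *
       ((blowup_adj W x y)%:R - W x.1 y.1 * 1) :> R.
    rewrite -sum_adj -sumrB big_mkcond /=; apply: eq_bigr => x _.
    case: (x \in X); last by rewrite big1 // => y _; rewrite !mul0r.
    rewrite -sumrB big_mkcond /=; apply: eq_bigr => y _.
    by case: (y \in X); rewrite ?mulr1 ?mul1r ?mul0r.
  have X2 : (rho * #|{: V}|%:R) ^+ 2 <= #|X|%:R ^+ 2.
    by rewrite ler_pXn2r ?nnegrE ?mulr_ge0 // ltW.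
  move: cX; rewrite -E ler_norml => /andP[cX _].
  have e1 : 2 * eta * #|{: V}|%:R ^+ 2 <= del * D * #|X|%:R ^+ 2.
    apply: (@le_trans _ _ (del * D * (rho * #|{: V}|%:R) ^+ 2)); last first.
      by rewrite ler_pM2l // mulr_gt0.
    have aux : 2 * eta <= del * D * rho ^+ 2 by lra.
    have := ler_wpM2r (sqr_ge0 (#|{: V}|%:R : R)) aux.
    set v := #|_|%:R; move=> h; apply: le_trans h _; rewrite le_eqVlt; apply/orP; left; apply/eqP; ring.
  set ed := #|edges_in _|%:R in cX *; set w := \sum_(_ in _) _ in cX lo.
  set x2 := _ ^+ 2 in lo e1 *; set v2 := _ ^+ 2 in cX e1; lra.
have := hG Gam (leq_trans Fn0 VA) dGam.
rewrite hom_densityE ler_pdivlMr ?exprn_gt0 ?ltr0n // card_edges -/m => lo.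
have K01 (x y : V) : 0 <= ((blowup_adj W x y)%:R : R) <= 1.
  by case: blowup_adj; rewrite ?lexx ?ler01.
have W01' (x y : V) : 0 <= W x.1 y.1 * 1 <= 1 by rewrite mulr1.
have := counting_lemma H V0 K01 W01' cut.
rewrite (hom_sum_pair H W (fun _ _ : F * F => 1)) hom_sum1 ler_norml -/m => /andP[_ up].
have VE : #|{: V}|%:R ^+ #|H| = #|A|%:R ^+ #|H| * #|{: F * F}|%:R ^+ #|H| :> R.
  by rewrite card_prod natrM exprMn.
have FF0 : 0 < #|{: F * F}|%:R ^+ #|H| :> R.
  by rewrite exprn_gt0 // ltr0n card_prod muln_gt0 F0.
rewrite -(ler_pM2r FF0).
suff : (1 - eps) * D ^+ m * #|{: V}|%:R ^+ #|H| <= hom_sum H W * #|{: F * F}|%:R ^+ #|H|.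
  by rewrite VE mulrA.
have lo' : (1 - del) * ((1 - del) * D) ^+ m * #|{: V}|%:R ^+ #|H| <=
   hom_sum H (fun x y : V => (blowup_adj W x y)%:R : R) := lo.
have V1 : 0 <= #|{: V}|%:R ^+ #|H| :> R by rewrite exprn_ge0.
have bern : 1 - eps / 2 <= (1 - del) ^+ m.+1.
  by rewrite -delE m1E; apply: bernoulli_sub; lra.
have b2 : (1 - eps / 2) * D ^+ m * #|{: V}|%:R ^+ #|H| <=
   (1 - del) * ((1 - del) * D) ^+ m * #|{: V}|%:R ^+ #|H|.
  by rewrite ler_wpM2r // exprMn mulrA -exprS ler_wpM2r // exprn_ge0 // ltW.
have b3 : m%:R * (2 * eta) <= eps / 2 * D ^+ m.
  apply: (@le_trans _ _ (m1 * (2 * eta))).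
    by rewrite m1E ler_wpM2r ?ler_nat ?leqnSn // mulr_ge0 // ltW.
  apply: (@le_trans _ _ (m1 * (2 * (eps * D ^+ m / (4 * m1))))).
    by rewrite ler_pM2l // ler_pM2l.
  by rewrite le_eqVlt; apply/orP; left; apply/eqP; field; rewrite lt0r_neq0.
have b4 := ler_wpM2r V1 b3.
set v := #|{: V}|%:R ^+ _ in b2 b4 lo' up *.
move: up; rewrite !mulrA in b2 b4 *; lra.
Qed.

(** * Weighted walk counts *)

Section Walks.
Variables (R : realType) (T : finType) (U : T -> T -> R).

Fixpoint walk s x y : R :=
  if s is s'.+1 then \sum_z U x z * walk s' z y else (x == y)%:R.

(** Indices above [s], in particular [s + 1], fall back to the endpoint [y]; this mirrors
    [subdiv_path]. *)
Definition walk_pt s (x y : T) (z : {ffun 'I_s -> T}) (i : nat) : T :=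
  if i is j.+1 then if insub j is Some j' then z j' else y else x.

Lemma sum_pick x (h : T -> R) : \sum_z (x == z)%:R * h z = h x.
Proof.
rewrite (bigD1 x) //= eqxx mul1r big1 ?addr0 // => z /negbTE nz.
by rewrite eq_sym nz mul0r.
Qed.

Lemma walkD s t x y : walk (s + t) x y = \sum_z walk s x z * walk t z y.
Proof.
elim: s x => [|s IH] x /=; first by rewrite sum_pick.
under eq_bigr do rewrite IH mulr_sumr.
rewrite exchange_big /=; apply: eq_bigr => z _; rewrite mulr_suml.
by apply: eq_bigr => w _; rewrite mulrA.
Qed.

Lemma walk1 x y : walk 1 x y = U x y.
Proof. by under [LHS]eq_bigr do rewrite mulrC eq_sym; rewrite sum_pick. Qed.

Lemma walkSr s x y : walk s.+1 x y = \sum_z walk s x z * U z y.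
Proof. by rewrite -addn1 walkD; under eq_bigr do rewrite walk1. Qed.

Lemma walk_sym : (forall x y, U x y = U y x) ->
  forall s x y, walk s x y = walk s y x.
Proof.
move=> Us; elim=> [|s IH] x y; first by rewrite /= eq_sym.
by rewrite walkSr; apply: eq_bigr => z _; rewrite mulrC Us IH.
Qed.

Hypothesis U01 : forall x y, 0 <= U x y <= 1.

Lemma walk_ge0 s x y : 0 <= walk s x y.
Proof.
elim: s x => [|s IH] x /=; first exact: ler0n.
by apply: sumr_ge0 => z _; rewrite mulr_ge0 //; have /andP[] := U01 x z.
Qed.

Lemma sum_walk_le s x : \sum_y walk s x y <= #|T|%:R ^+ s.
Proof.
elim: s x => [|s IH] x /=.
  by rewrite -[X in _ <= X](sum_pick x (fun=> 1)); under [leRHS]eq_bigr do rewrite mulr1.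
rewrite exchange_big /= exprS mulr_natl -sumr_const; apply: ler_sum => z _.
apply: le_trans (IH z); apply: ler_sum => y _.
by have /andP[_ h] := U01 x z; rewrite ler_piMl // walk_ge0.
Qed.

(** With both ends fixed only the [s] inner vertices are free. This allows walk counts to be
    rescaled to a kernel with values in [0, 1]. *)
Lemma walkS_le s x y : walk s.+1 x y <= #|T|%:R ^+ s.
Proof.
rewrite walkSr; apply: le_trans (sum_walk_le s x); apply: ler_sum => z _.
by have /andP[_ h] := U01 z y; rewrite ler_piMr // walk_ge0.
Qed.

Lemma sum_walk_pt s x y :
  \sum_(z : {ffun 'I_s -> T}) \prod_(i < s.+1)
     U (walk_pt x y z i) (walk_pt x y z i.+1) = walk s.+1 x y.
Proof.
elim: s x => [|s IH] x.
  rewrite walk1 (big_pred1 [ffun=> x]); last first.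
    by move=> f; apply/esym/eqP/ffunP => -[].
  by rewrite big_ord_recl big_ord0 mulr1 /= insubF.
have -> : walk s.+2 x y = \sum_t U x t * walk s.+1 t y by [].
rewrite sum_ffun_ordS; apply: eq_bigr => t _.
rewrite -IH mulr_sumr; apply: eq_bigr => g _.
set z := finfun _.
(* Forgetting the starting vertex shifts all positions by one. *)
have ptS j : walk_pt x y z j.+1 = walk_pt t y g j.
  rewrite /walk_pt; case: j => [|j].
    by rewrite insubT /z ffunE (_ : Sub _ _ = ord0) ?unlift_none //; apply: val_inj.
  case: insubP => [j' _ j'E|js]; last by rewrite insubF //; apply/negbTE.
  rewrite /z ffunE; case: unliftP => [k|] E; last by rewrite E in j'E.
  have kE : k = j :> nat by move: j'E; rewrite E /= /bump /= add1n => -[].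
  by rewrite -kE valK.
rewrite big_ord_recl ptS; congr (_ * _).
by apply: eq_bigr => i _; rewrite !ptS.
Qed.

End Walks.

Lemma walk_pair (R : realType) (A B : finType) (U : A -> A -> R)
    (V : B -> B -> R) s (p p' : A * B) :
  walk (fun p p' => U p.1 p'.1 * V p.2 p'.2) s p p' =
  walk U s p.1 p'.1 * walk V s p.2 p'.2.
Proof.
elim: s p => [|s IH] p /=; first by rewrite -pair_eqE -mulnb natrM.
rewrite big_distrlr /= pair_bigA /=; apply: eq_bigr => z _.
by rewrite IH; ring.
Qed.

(** * Homomorphisms, edges and bipartiteness of subdivisions *)

Section SubdivisionHoms.
Variables (R : realType) (H G : sgraph) (s : nat).

Lemma is_hom_subdivision (f : {ffun subdivision s H -> G}) :
  is_hom f = [forall e : oedge H, forall i : 'I_s.+1,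
    adj (f (subdiv_path s e i)) (f (subdiv_path s e i.+1))].
Proof.
apply/forallP/forallP => [hf e|hf x].
  apply/forallP => i; have /forallP/(_ (subdiv_path s e i.+1))/implyP := hf (subdiv_path s e i).
  by apply; apply/existsP; exists e; apply/existsP; exists i; rewrite !eqxx.
apply/forallP => y; apply/implyP => /existsP[e /existsP[i]].
have /forallP/(_ i) a := hf e.
by case/orP=> /andP[/eqP -> /eqP ->] //; rewrite adj_sym.
Qed.

(** Once the old vertices are placed, the inner vertices of different edges are chosen
    independently, so the count factors into one walk count for each edge of [H]. *)
Lemma hom_density_subdivision :
  hom_density R (subdivision s H) G =
  hom_sum H (walk (adjr R (G := G)) s.+1) /
    #|G|%:R ^+ (#|H| + s * #|{: oedge H}|).
Proof.
rewrite /hom_density card_ffun natrX card_sum card_prod card_ord [(s * _)%N]mulnC.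
congr (_ / _).
rewrite -sum1_card natr_sum big_mkcond.
rewrite (eq_bigr (fun f : {ffun subdiv_vertex s H -> G} => \prod_(e : oedge H) \prod_(i < s.+1)
  adjr R (f (subdiv_path s e i)) (f (subdiv_path s e i.+1)))); last first.
  move=> f _; rewrite inE is_hom_subdivision; case: forallP => [hf|/forallP].
    rewrite big1 // => e _; rewrite big1 // => i _.
    by have /forallP/(_ i) := hf e; rewrite /adjr => ->.
  rewrite negb_forall => /existsP[e]; rewrite negb_forall => /existsP[i ne].
  by rewrite (bigD1 e) //= (bigD1 i) //= /adjr (negbTE ne) !mul0r.
rewrite sum_ffun_sum; apply: eq_bigr => a _.
rewrite sum_ffun_curry.
under [RHS]eq_bigr do rewrite -sum_walk_pt.
rewrite bigA_distr_bigA; apply: eq_bigr => b _.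
apply: eq_bigr => e _; apply: eq_bigr => i _.
have E j : [ffun x => match x with inl i0 => a i0
    | inr j => [ffun x0 => b x0.1 x0.2] j end] (subdiv_path s e j) =
    walk_pt (a (val e).1) (a (val e).2) (b e) j.
  rewrite /subdiv_path /walk_pt; case: j => [|j]; first by rewrite ffunE.
  by case: insubP => [j' _ _|_]; rewrite !ffunE.
by rewrite (E i) (E i.+1).
Qed.

End SubdivisionHoms.

Section SubdivisionEdges.
Variables (H : sgraph) (s : nat).

Lemma subdiv_path_inner (e : oedge H) j (js : (j < s)%N) :
  subdiv_path s e j.+1 = inr (e, Ordinal js).
Proof.
by rewrite /subdiv_path; case: insubP => [i _ E|]; [congr (inr (_, _)); apply: val_inj|rewrite js].
Qed.

Lemma subdiv_path_last (e : oedge H) : subdiv_path s e s.+1 = inl (val e).2.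
Proof. by rewrite /subdiv_path insubF // ltnn. Qed.

Lemma subdiv_path_edge (e e' : oedge H) j j' : (0 < j <= s)%N ->
  subdiv_path s e j = subdiv_path s e' j' -> e = e'.
Proof.
case: j => [|j] // /andP[_ js]; rewrite (subdiv_path_inner _ js); case: j' => [|j'] //=.
by case: insubP => // ? _ _ [].
Qed.

Lemma subdiv_path_inj (e : oedge H) j j' :
  subdiv_path s e j = subdiv_path s e j' ->
  (j <= s.+1)%N -> (j' <= s.+1)%N -> j = j'.
Proof.
move=> E js js'; move: js js' E.
have aux i : (i <= s.+1)%N -> [\/ i = 0%N, i = s.+1 | exists2 l, (l < s)%N & i = l.+1].
  case: i => [|i]; first by constructor 1.
  by rewrite ltnS leq_eqVlt => /orP[/eqP ->|h]; [constructor 2|constructor 3; exists i].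
have ne := oedge_neq e.
case/aux=> [->|->|[l ls ->]]; case/aux=> [->|->|[l' ls' ->]] //.
- by rewrite subdiv_path_last => -[E]; rewrite E eqxx in ne.
- by rewrite subdiv_path_inner.
- by rewrite subdiv_path_last => -[E]; rewrite E eqxx in ne.
- by rewrite subdiv_path_last subdiv_path_inner.
- by rewrite subdiv_path_inner.
- by rewrite subdiv_path_last subdiv_path_inner.
- by rewrite !subdiv_path_inner => -[->].
Qed.

Lemma card_edges_subdivision : (0 < s)%N ->
  #|edges (subdivision s H)| = (s.+1 * #|{: oedge H}|)%N.
Proof.
move=> s0.
pose E (p : oedge H * 'I_s.+1) : {set subdivision s H} :=
  [set subdiv_path s p.1 p.2; subdiv_path s p.1 p.2.+1].
have -> : edges (subdivision s H) = [set E p | p : oedge H * 'I_s.+1].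
  apply/setP => x; apply/imsetP/imsetP => [[[u v]]|[[e i] _ ->]].
    rewrite inE /= => /existsP[e /existsP[i /orP[]/andP[/eqP -> /eqP ->]]] ->.
      by exists (e, i).
    by exists (e, i); rewrite // /E /= setUC.
  exists (subdiv_path s e i, subdiv_path s e i.+1) => //.
  by rewrite inE; apply/existsP; exists e; apply/existsP; exists i; rewrite !eqxx.
rewrite card_imset; first by rewrite card_prod card_ord mulnC.
move=> [e i] [e' i'] EE.
have in1 : subdiv_path s e i \in E (e', i') by rewrite -EE !inE eqxx.
have in2 : subdiv_path s e i.+1 \in E (e', i') by rewrite -EE !inE eqxx orbT.
(* As [s] is positive, one end of the path edge is an inner vertex, and it determines [e]: the
   second end if [i = 0], the first one otherwise. *)
have ee' : e = e'.
  have := ltn_ord i; rewrite ltnS => is'.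
  have [i0|i0] := posnP i.
    move: in2; rewrite !inE => /orP[] /eqP /subdiv_path_edge; apply; by rewrite i0.
  by move: in1; rewrite !inE => /orP[] /eqP /subdiv_path_edge; apply; rewrite i0.
subst e'; congr (_, _); apply: val_inj => /=.
have li := ltn_ord i; have li' := ltn_ord i'.
have l1 : (i <= s.+1)%N by lia.
have l1' : (i' <= s.+1)%N by lia.
move: in1 in2; rewrite /E /fst /snd !inE.
move=> /orP[] /eqP /subdiv_path_inj h1 /orP[] /eqP /subdiv_path_inj h2.
all: have {}h1 := h1 ltac:(lia) ltac:(lia); have {}h2 := h2 ltac:(lia) ltac:(lia); lia.
Qed.

(** Vertices are coloured by the parity of their position on a path. Since [s + 1] is even, both
    ends of every path get the same colour, which makes the colouring consistent on old vertices. *)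
Lemma bipartite_subdivision : odd s -> bipartite (subdivision s H).
Proof.
move=> os.
pose c (x : subdivision s H) := if x is inr (_, j) then odd j else true.
exists [set x | c x] => u v.
have cp e i : (i <= s.+1)%N -> c (subdiv_path s e i) = ~~ odd i.
  case: i => [|i] //; rewrite ltnS leq_eqVlt => /orP[/eqP ->|h].
    by rewrite subdiv_path_last /= os.
  by rewrite subdiv_path_inner /= negbK.
case/existsP=> e /existsP[i /orP[]/andP[/eqP -> /eqP ->]]; rewrite !inE;
  have li := ltn_ord i; rewrite !cp ?(ltnW li) //=; by case: odd.
Qed.

End SubdivisionEdges.

Lemma hom_density_K2 (R : realType) (G : sgraph) :
  hom_density R (complete_graph 2) G =
  (\sum_(x : G) \sum_y adjr R x y) / #|G|%:R ^+ 2.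
Proof.
rewrite /hom_density card_ffun card_ord natrX; congr (_ / _).
rewrite -sum1_card natr_sum big_mkcond (sum_ffun_ordS (T := G)).
apply: eq_bigr => x _; rewrite sum_ffun_ordS; apply: eq_bigr => y _.
rewrite (big_pred1 [ffun=> x]); last first.
  by move=> f; apply/esym/eqP/ffunP => -[].
set f := [ffun=> _] : {ffun complete_graph 2 -> G}.
have f0 : f ord0 = x by rewrite ffunE unlift_none.
have f1 : f (lift ord0 ord0) = y by rewrite ffunE liftK ffunE unlift_none.
rewrite inE (_ : is_hom f = adj x y); first by rewrite /adjr; case: adj.
apply/forallP/idP => [/(_ ord0)/forallP/(_ (lift ord0 ord0))/implyP|a u].
  by rewrite f0 f1; apply.
apply/forallP => v; apply/implyP; rewrite /= /complete_adj.
case: (unliftP ord0 u) => [u'|] ->; rewrite ?(ord1 u').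
  case: (unliftP ord0 v) => [v'|] ->; rewrite ?(ord1 v') ?eqxx // f0 f1 adj_sym //.
by case: (unliftP ord0 v) => [v'|] ->; rewrite ?(ord1 v') ?eqxx // f0 f1.
Qed.

(** * Subsets of large minimum degree and walks inside them *)

Section MinDegree.
Variables (R : realType) (T : finType) (U : T -> T -> R).
Hypothesis Usym : forall x y, U x y = U y x.
Hypothesis U01 : forall x y, 0 <= U x y <= 1.

Let U0 x y : 0 <= U x y. Proof. by have /andP[] := U01 x y. Qed.

Definition pair_sum (S : {set T}) : R := \sum_(x in S) \sum_(y in S) U x y.

(** Deleting [x] removes a row and a column with equal sums by symmetry; counting the diagonal entry
    twice gives the inequality. *)
Lemma pair_sumD1 (S : {set T}) x : x \in S ->
  pair_sum S <= pair_sum (S :\ x) + 2 * \sum_(y in S) U x y.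
Proof.
move=> xS; rewrite /pair_sum (big_setD1 x) //=.
have E z : \sum_(y in S) U z y = U z x + \sum_(y in S :\ x) U z y by rewrite (big_setD1 x).
rewrite [X in _ + X <= _](eq_bigr (fun z => U z x + \sum_(y in S :\ x) U z y)) //.
rewrite big_split /=.
have -> : \sum_(z in S :\ x) U z x = \sum_(z in S :\ x) U x z by apply: eq_bigr.
have := U0 x x; rewrite E; lra.
Qed.

Lemma pair_sum_setC S : pair_sum S + pair_sum (~: S) <= pair_sum [set: T].
Proof.
have split (h : T -> R) : \sum_(x in [set: T]) h x = \sum_(x in S) h x + \sum_(x in ~: S) h x.
  rewrite (bigID (mem S)) /=; congr (_ + _); apply: eq_bigl => x; by rewrite !inE.
rewrite /pair_sum split; apply: lerD; apply: ler_sum => x _; rewrite split.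
  by rewrite lerDl; apply: sumr_ge0.
by rewrite lerDr; apply: sumr_ge0.
Qed.

(* [S] maximises [pair_sum S - g * #|S|]. *)
Lemma min_degree_set (g : R) : 0 <= g -> exists S : {set T},
  [/\ forall x, x \in S -> g / 2 <= \sum_(y in S) U x y,
      pair_sum [set: T] - g * #|T|%:R <= pair_sum S &
      pair_sum (~: S) <= g * #|~: S|%:R].
Proof.
move=> g0; pose phi S := pair_sum S - g * #|S|%:R.
have [S _ Smax] := @Order.TotalTheory.arg_maxP _ _ _ set0 predT phi isT.
exists S; split.
- move=> x xS; have := Smax (S :\ x) isT; have := pair_sumD1 xS.
  rewrite /phi (cardsD1 x S) xS natrD /=; lra.
- have := Smax setT isT; rewrite /phi cardsT /=.
  have : 0 <= g * #|S|%:R by rewrite mulr_ge0.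
  lra.
- have := Smax setT isT; have := pair_sum_setC S; rewrite /phi cardsT -(cardsC S) natrD /=.
  lra.
Qed.

(** Walks that stay in [S] already suffice. The first step keeps the true degree of [x] instead of
    the minimum [c], which is what a dyadic level set of the degree exploits. *)
Lemma walk_row_geS (S : {set T}) c s x : 0 <= c ->
  (forall x, x \in S -> c <= \sum_(y in S) U x y) -> x \in S ->
  (\sum_(y in S) U x y) * c ^+ s <= \sum_y walk U s.+1 x y.
Proof.
move=> c0 Sc; elim: s x => [|s IH] x xS.
  rewrite mulr1; under [leRHS]eq_bigr do rewrite walk1.
  by rewrite [leRHS](bigID (mem S)) /= lerDl; apply: sumr_ge0.
have -> : \sum_y walk U s.+2 x y = \sum_z U x z * \sum_y walk U s.+1 z y.
  by rewrite exchange_big; apply: eq_bigr => z _; rewrite mulr_sumr.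
have w0 z : 0 <= \sum_y walk U s.+1 z y.
  by apply: sumr_ge0 => y _; apply: walk_ge0.
rewrite [leRHS](bigID (mem S)); apply: ler_wpDr.
  by apply: sumr_ge0 => z _; rewrite mulr_ge0.
rewrite mulr_suml; apply: ler_sum => z zS; apply: ler_wpM2l => //.
apply: le_trans (IH z zS); rewrite exprS ler_wpM2r ?exprn_ge0 //; exact: Sc.
Qed.

Lemma walk_row_ge (S : {set T}) c s x : 0 <= c ->
  (forall x, x \in S -> c <= \sum_(y in S) U x y) -> x \in S ->
  c ^+ s <= \sum_y walk U s x y.
Proof.
move=> c0 Sc xS; case: s => [|s].
  by rewrite expr0 -[leLHS](sum_pick x (fun=> 1)); under eq_bigr do rewrite mulr1.
apply: le_trans (walk_row_geS s c0 Sc xS).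
by rewrite exprS ler_wpM2r ?exprn_ge0 //; exact: Sc.
Qed.

End MinDegree.

(** * Quadratic forms of walk kernels *)

Section WalkForms.
Variables (R : realType) (A T : finType) (i : A -> T) (U : T -> T -> R).
Hypothesis Usym : forall x y, U x y = U y x.
Variables (f : A -> R) (s : nat).

Definition walk_push (z : T) : R := \sum_x f x * walk U s (i x) z.

(** A walk of even length is cut at its middle vertex, which exhibits the form as a sum of
    squares. *)
Lemma walk_form_even :
  \sum_x \sum_y f x * f y * walk U (s + s) (i x) (i y) =
  \sum_z walk_push z ^+ 2.
Proof.
under [RHS]eq_bigr do rewrite expr2 big_distrlr.
rewrite [RHS]exchange_big; apply: eq_bigr => x _.
rewrite [RHS]exchange_big; apply: eq_bigr => y _ /=.
rewrite walkD mulr_sumr; apply: eq_bigr => z _.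
by rewrite (walk_sym Usym s z); ring.
Qed.

(** A walk of odd length is cut at its middle edge, which leaves the form of [U] itself on the
    pushed weights. *)
Lemma walk_form_odd :
  \sum_x \sum_y f x * f y * walk U (s + s.+1) (i x) (i y) =
  \sum_z \sum_w walk_push z * walk_push w * U z w.
Proof.
under [RHS]eq_bigr => z _ do under eq_bigr => w _ do
  rewrite big_distrlr mulr_suml.
under [RHS]eq_bigr => z _ do rewrite exchange_big.
rewrite [RHS]exchange_big; apply: eq_bigr => x _.
under [RHS]eq_bigr => z _ do under eq_bigr => w _ do rewrite mulr_suml.
under [RHS]eq_bigr => z _ do rewrite exchange_big.
rewrite [RHS]exchange_big; apply: eq_bigr => y _ /=.
rewrite walkD mulr_sumr; apply: eq_bigr => z _.
rewrite /= !mulr_sumr; apply: eq_bigr => w _.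
by rewrite (walk_sym Usym s w); ring.
Qed.

Lemma sum_walk_push :
  \sum_z walk_push z = \sum_x f x * \sum_z walk U s (i x) z.
Proof. by rewrite exchange_big; apply: eq_bigr => x _; rewrite mulr_sumr. Qed.

End WalkForms.

(** Only maps into the image of [i] are kept, and each edge gives back one factor [M] of the
    normalisation. *)
Lemma hom_sum_restrict (R : realType) (H : sgraph) (A T : finType)
    (i : A -> T) (U : T -> T -> R) (M : R) :
  injective i -> (forall x y, 0 <= U x y) -> 0 < M ->
  hom_sum H (fun x y => U (i x) (i y) / M) * M ^+ #|{: oedge H}| <= hom_sum H U.
Proof.
move=> inji U0 M0.
have := sum_comp_inj_le (I := H) (G := fun f => \prod_(e : oedge H) U (f (val e).1) (f (val e).2)) inji.
move=> /(_ _)h; apply: le_trans (h _); last by move=> f; apply: prodr_ge0.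
rewrite mulr_suml; apply: ler_sum => f _; rewrite le_eqVlt; apply/orP; left; apply/eqP.
rewrite -prodr_const -big_split /=; apply: eq_bigr => e _.
by rewrite !ffunE divfK // lt0r_neq0.
Qed.

(** * Local density: from vertex sets to weights *)

Section Rounding.
Variables (R : realType) (T : finType) (U : T -> T -> R).
Hypothesis Uxx : forall x, U x x = 0.

(** Here [lam] is a Lagrange multiplier for the total weight. *)
Definition penalized (lam : R) (f : T -> R) : R :=
  (\sum_x \sum_y f x * f y * U x y) - lam * \sum_x f x.

(* With zero diagonal the penalised form is affine in each coordinate, so each
   coordinate can be moved to [0] or [1] without increasing it. *)
Lemma penalized_round1 lam (f : T -> R) u : unit_fun f ->
  exists b : bool, penalized lam (fun x => if x == u then b%:R else f x) <= penalized lam f.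
Proof.
move=> f01.
pose a := (\sum_(x | x != u) \sum_(y | y != u) f x * f y * U x y) -
   lam * \sum_(x | x != u) f x.
pose b := \sum_(y | y != u) f y * U u y + \sum_(x | x != u) f x * U x u - lam.
have aff (g : T -> R) : (forall x, x != u -> g x = f x) -> penalized lam g = a + g u * b.
  move=> gf.
  have e1 : \sum_(y | y != u) g u * g y * U u y = g u * \sum_(y | y != u) f y * U u y.
    by rewrite mulr_sumr; apply: eq_bigr => y yu; rewrite (gf y) // mulrA.
  have e2 x : x != u -> \sum_y g x * g y * U x y =
      g u * (f x * U x u) + \sum_(y | y != u) f x * f y * U x y.
    move=> xu; rewrite (bigD1 u) //= (gf x) //; congr (_ + _); first by ring.
    by apply: eq_bigr => y yu; rewrite (gf y).
  rewrite /penalized (bigD1 u) //= (eq_bigr _ e2) (bigD1 u) //= Uxx mulr0 add0r e1.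
  rewrite [\sum_x g x](bigD1 u) //= (eq_bigr f gf).
  rewrite big_split /= -mulr_sumr /a /b; ring.
have /andP[fu0 fu1] := f01 u.
have [b0|b0] := lerP 0 b.
  exists false; rewrite !aff //=; last by move=> x /negbTE ->.
  by rewrite eqxx mul0r addr0 lerDl mulr_ge0.
exists true; rewrite !aff //=; last by move=> x /negbTE ->.
by rewrite eqxx mul1r; nra.
Qed.

(** Rounding the coordinates one after another turns the weight into the indicator of a set. *)
Lemma penalized_round lam (f : T -> R) : unit_fun f ->
  exists X : {set T}, pair_sum U X - lam * #|X|%:R <= penalized lam f.
Proof.
move=> f01.
suff [g [g01 gb gf]] : exists g : T -> R, [/\ unit_fun g,
    forall x, x \in enum T -> g x = 0 \/ g x = 1 & penalized lam g <= penalized lam f].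
  exists [set x | g x == 1]; apply: le_trans gf.
  have gE x : g x = (x \in [set x | g x == 1])%:R.
    rewrite inE; have [->|->] : g x = 0 \/ g x = 1 by apply: gb; rewrite mem_enum.
      by rewrite eq_sym oner_eq0.
    by rewrite eqxx.
  rewrite /penalized /pair_sum -sum1_card natr_sum.
  rewrite le_eqVlt; apply/orP; left; apply/eqP; congr (_ - _ * _).
    rewrite big_mkcond; apply: eq_bigr => x _; rewrite [g x]gE.
    case: (x \in _); last by rewrite big1 // => y _; rewrite !mul0r.
    rewrite big_mkcond; apply: eq_bigr => y _; rewrite [g y]gE.
    by case: (y \in _); rewrite ?mul1r ?mulr0 ?mul0r.
  by rewrite big_mkcond; apply: eq_bigr => x _; rewrite [g x]gE; case: (x \in _).
elim: (enum T) => [|u r [g [g01 gb gf]]]; first by exists f.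
have [b hb] := penalized_round1 lam u g01.
exists (fun x => if x == u then b%:R else g x); split.
- by move=> x; case: eqP => // _; case: b {hb}; rewrite /= ?lexx ?ler01.
- move=> x; rewrite inE; case: eqP => /= [_ _|_ /gb//].
  by case: b {hb}; [right|left].
- exact: le_trans gf.
Qed.
End Rounding.

(** The weight is rounded to a set [X]. If [X] is large, local density applies to it; if it is
    small, the penalty alone gives the bound. *)
Lemma dense_weighted (R : realType) (G : sgraph) (rho d : R) (h : G -> R) :
  dense rho d G -> 0 < d -> unit_fun h ->
  2 * rho * #|G|%:R <= \sum_x h x -> 0 <= \sum_x h x ->
  d * (\sum_x h x) ^+ 2 <= \sum_x \sum_y h x * h y * adjr R x y.
Proof.
move=> dG d0 h01; set s := \sum_x h x => hs s0.
have Uxx x : adjr R (G := G) x x = 0 by rewrite /adjr adj_irrefl.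
(* This multiplier makes the bound for large [X] equal to [d * s ^ 2 + d * (s - #|X|) ^ 2]. For
   small [X] the hypothesis on the total weight gives [#|X| <= s / 2]. *)
have [X] := penalized_round Uxx (2 * d * s) h01.
rewrite /penalized -/s; set Q := \sum_x _; move=> hX.
have [big|small] := lerP (rho * #|G|%:R) #|X|%:R.
  have := dG X big; have E : pair_sum (adjr R (G := G)) X = _ := sum_adj R X.
  move=> lo; rewrite E in hX.
  have : 0 <= d * (s - #|X|%:R) ^+ 2 by rewrite mulr_ge0 ?sqr_ge0 // ltW.
  nra.
have : 0 <= pair_sum (adjr R (G := G)) X.
  by apply: sumr_ge0 => x _; apply: sumr_ge0 => y _; apply: ler0n.
have : 0 <= d * s * (s - 2 * #|X|%:R).
  by rewrite !mulr_ge0 ?(ltW d0) //; lra.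
nra.
Qed.

(** * Odd walks in locally dense graphs: part (b) *)

Lemma adjr01 (R : realType) (G : sgraph) (x y : G) : 0 <= adjr R x y <= 1.
Proof. by rewrite /adjr; case: adj; rewrite ?lexx ?ler01. Qed.

Lemma adjrC (R : realType) (G : sgraph) (x y : G) : adjr R x y = adjr R y x.
Proof. by rewrite /adjr adj_sym. Qed.

Lemma walk_scaled01 (R : realType) (T : finType) (U : T -> T -> R) s x y :
  (0 < #|T|)%N -> (forall x y, 0 <= U x y <= 1) ->
  0 <= walk U s.+1 x y / #|T|%:R ^+ s <= 1.
Proof.
move=> T0 U01; have n0 : 0 < #|T|%:R ^+ s :> R by rewrite exprn_gt0 // ltr0n.
rewrite divr_ge0 ?walk_ge0 // ?(ltW n0) //= ler_pdivrMr // mul1r.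
exact: walkS_le.
Qed.

(** The complement of the minimum degree set spans few edges, so by local density it has at most
    half of the vertices. *)
Lemma dense_core (R : realType) (G : sgraph) (rho d : R) :
  0 < d -> rho <= 1 / 2 -> dense rho d G -> exists S : {set G},
  #|G|%:R / 2 <= #|S|%:R :> R /\
  forall x, x \in S -> d * #|G|%:R / 4 <= \sum_(y in S) adjr R x y.
Proof.
move=> d0 rho2 dG; set n : R := #|G|%:R; have n0 : 0 <= n by [].
have g0 : 0 <= d * n / 2 by rewrite divr_ge0 // mulr_ge0 // ltW.
have [S [Sdeg _ SC]] := min_degree_set (@adjrC R G) (@adjr01 R G) g0.
exists S; split; last by move=> x /Sdeg; lra.
have cS : #|S|%:R + #|~: S|%:R = n by rewrite -natrD cardsC.
have [big|small] := lerP (rho * n) #|~: S|%:R; last first.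
  have : rho * n <= 1 / 2 * n by rewrite ler_wpM2r.
  lra.
have lo := dG _ big.
have E : pair_sum (adjr R (G := G)) (~: S) = _ := sum_adj R (~: S).
rewrite E in SC.
set y : R := #|~: S|%:R in cS SC lo *.
have y0 : 0 <= y by [].
have le1 : d * y * y <= d * y * (n / 2) by nra.
have [y00|yp] := eqVneq y 0; first by lra.
have yp' : 0 < d * y by rewrite mulr_gt0 // lt_def yp.
move: le1; rewrite ler_pM2l //; lra.
Qed.

Lemma weakly_KNRS_subdivision (R : realType) (k : nat) (H : sgraph) :
  (0 < k)%N -> KNRS R H -> weakly_KNRS R (subdivision (2 * k) H).
Proof.
move=> k0 hH; set m := #|{: oedge H}|; set v := #|H|.
(* The factors come from [eps = 1 / 2] in the kernel bound, from the degrees [d * n / 4] along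
   [2 * k] steps for each edge, and from the core having at least half of the vertices. *)
exists (2^-1 * (4^-1 ^+ (2 * k)) ^+ m * 2^-1 ^+ v).
  have h2 : 0 < (2^-1 : R) <= 1 by apply/andP; split; lra.
  have h4 : 0 < (4^-1 : R) <= 1 by apply/andP; split; lra.
  case/andP: h2 => a0 a1; case/andP: h4 => b0 b1.
  rewrite !mulr_gt0 ?exprn_gt0 //=.
  by rewrite !mulr_ile1 ?mulr_ge0 ?exprn_ge0 ?exprn_ile1 ?exprn_ge0 // ltW.
(* The middle edge of a walk gives [d] by local density, and each of the [k] steps on either side
   gives [d / 4]. *)
move=> d d0; pose D := d * (d / 4) ^+ (2 * k).
have d4 : 0 < d / 4 by rewrite divr_gt0.
have D0 : 0 < D by rewrite mulr_gt0 // exprn_gt0.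
have [|rhoH rhoH0 hker] := KNRS_kernel hH D0 (eps := 1 / 2).
  by apply/andP; split; lra.
(* The bound 1/2 is for [dense_core]. The other makes the pushed weight, of total at least
   [(d / 4) ^ k * rhoH * n / 2], heavy enough for [dense_weighted]. *)
pose rho := Num.min (1 / 2) ((d / 4) ^+ k * rhoH / 4).
have dk : 0 < (d / 4) ^+ k by rewrite exprn_gt0.
have rho0 : 0 < rho.
  by rewrite lt_min; apply/andP; split; [lra|rewrite divr_gt0 // mulr_gt0].
exists rho => //; exists 1%N => G n1 dG.
have rho1 : rho <= 1 / 2 by rewrite ge_min lexx.
have rho2 : rho <= (d / 4) ^+ k * rhoH / 4 by rewrite ge_min lexx orbT.
have [S [cS Sdeg]] := dense_core d0 rho1 dG.
set n : R := #|G|%:R in cS Sdeg *.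
have n0 : 0 < n by rewrite ltr0n.
have nk : 0 < n ^+ k by rewrite exprn_gt0.
pose A := {x : G | x \in S}; pose U := adjr R (G := G).
have cA : #|{: A}| = #|S| by rewrite card_sig; apply: eq_card => x; rewrite !inE.
have A0 : (0 < #|{: A}|)%N by rewrite -(ltr0n R) cA; apply: lt_le_trans cS; rewrite divr_gt0.
pose W (x y : A) := walk U (2 * k).+1 (val x) (val y) / n ^+ (2 * k).
have Usym : forall x y, U x y = U y x := @adjrC R G.
have U01 : forall x y, 0 <= U x y <= 1 := @adjr01 R G.
have Wsym x y : W x y = W y x by rewrite /W walk_sym.
have W01 x y : 0 <= W x y <= 1 by apply: walk_scaled01.
have dW : kernel_dense rhoH D W.
  move=> f f01 hf.
  have c0 : 0 <= d * n / 4 by rewrite divr_ge0 // mulr_ge0 // ltW.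
  have f0 x : 0 <= f x by have /andP[] := f01 x.
  pose h z := walk_push val U f k z / n ^+ k.
  have row (x : A) : (d / 4) ^+ k * n ^+ k <= \sum_z walk U k (val x) z.
    rewrite -exprMn (_ : d / 4 * n = d * n / 4); last by ring.
    exact: walk_row_ge Sdeg (valP x).
  have hsum : (d / 4) ^+ k * \sum_x f x <= \sum_z h z.
    rewrite -mulr_suml ler_pdivlMr // sum_walk_push mulr_sumr mulr_suml.
    apply: ler_sum => x _; rewrite mulrAC mulrC ler_wpM2l //; exact: row.
  have sf0 : 0 <= \sum_x f x by apply: sumr_ge0.
  have h01 : unit_fun h.
    move=> z; have p0 : 0 <= walk_push val U f k z.
      by apply: sumr_ge0 => x _; rewrite mulr_ge0 // walk_ge0.
    rewrite divr_ge0 ?(ltW nk) //= ler_pdivrMr // mul1r.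
    apply: le_trans (sum_walk_le U01 k z).
    apply: (@le_trans _ _ (\sum_(x : A) walk U k z (val x))).
      apply: ler_sum => x _; rewrite (walk_sym Usym) ler_piMl ?walk_ge0 //.
      by have /andP[] := f01 x.
    by apply: (sum_inj_le (c := val) (G := walk U k z)) => [|y]; [exact: val_inj|exact: walk_ge0].
  have hs0 : 0 <= \sum_z h z.
    by apply: sumr_ge0 => z _; have /andP[] := h01 z.
  have big : 2 * rho * n <= \sum_z h z.
    apply: le_trans hsum.
    have : (d / 4) ^+ k * (rhoH * #|{: A}|%:R) <= (d / 4) ^+ k * \sum_x f x.
      by rewrite ler_pM2l.
    apply: le_trans; rewrite cA.
    have e1 : 2 * rho * n <= 2 * ((d / 4) ^+ k * rhoH / 4) * n.
      by rewrite ler_pM2r // ler_pM2l.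
    apply: le_trans e1 _.
    have : (d / 4) ^+ k * rhoH * (n / 2) <= (d / 4) ^+ k * rhoH * #|S|%:R.
      by rewrite ler_pM2l // mulr_gt0.
    lra.
  have Q := dense_weighted dG d0 h01 big hs0.
  have E : \sum_x \sum_y f x * f y * W x y = \sum_x \sum_y h x * h y * adjr R x y.
    transitivity ((\sum_x \sum_y f x * f y * walk U (k + k.+1) (val x) (val y)) / n ^+ (2 * k)).
      rewrite mulr_suml; apply: eq_bigr => x _; rewrite mulr_suml; apply: eq_bigr => y _.
      by rewrite /W addnS addnn -mul2n mulrA.
    rewrite walk_form_odd // mulr_suml; apply: eq_bigr => z _.
    rewrite mulr_suml; apply: eq_bigr => w _.
    by rewrite /h mulnC exprM; field; rewrite lt0r_neq0.
  rewrite E; apply: le_trans Q; rewrite /D -mulrA ler_pM2l // mulnC exprM -exprMn.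
  by rewrite ler_pXn2r ?nnegrE // mulr_ge0 // ltW.
have lo := hker {x : G | x \in S} W A0 Wsym W01 dW.
have nk2 : 0 < n ^+ (2 * k) by rewrite exprn_gt0.
have U0 x y : 0 <= walk U (2 * k).+1 x y by apply: walk_ge0.
have up := @hom_sum_restrict R H A G val _ _ val_inj U0 nk2.
rewrite hom_density_subdivision card_edges_subdivision ?muln_gt0 // -/m -/v -/n.
rewrite ler_pdivlMr ?exprn_gt0 //; apply: le_trans up.
rewrite exprD [X in _ * (_ * X)]exprM [X in _ <= X](_ : _ = hom_sum H W * (n ^+ (2 * k)) ^+ m) //.
rewrite mulrA ler_pM2r ?exprn_gt0 //; apply: le_trans lo.
rewrite cA -/m -/v /D.
have cSv : (n / 2) ^+ v <= #|S|%:R ^+ v.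
  by rewrite lerXn2r ?nnegrE // divr_ge0 // ltW.
apply: (@le_trans _ _ ((1 - 1 / 2) * (d * (d / 4) ^+ (2 * k)) ^+ m * (n / 2) ^+ v)); last first.
  by rewrite ler_pM2l // mulr_gt0 ?exprn_gt0 //; lra.
rewrite le_eqVlt; apply/orP; left; apply/eqP.
rewrite (_ : 1 - 1 / 2 = 2^-1); last by lra.
by rewrite (exprM d) exprS !exprMn; ring.
Qed.

(** * Tools for part (a): isolated vertices, dyadic levels, the tensor power trick *)

Section Isolated.
Variables (R : realType) (H : sgraph) (T : finType) (U : T -> T -> R).
Variable A : {set T}.
Hypothesis U0 : forall x y, 0 <= U x y.

Definition nonisolated : {set H} :=
  [set u | [exists e : oedge H, (u == (val e).1) || (u == (val e).2)]].

Lemma card_nonisolated : (#|nonisolated| <= 2 * #|{: oedge H}|)%N.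
Proof.
pose p (x : oedge H * bool) := if x.2 then (val x.1).1 else (val x.1).2.
have sub : nonisolated \subset [set p x | x : oedge H * bool].
  apply/subsetP => u; rewrite inE => /existsP[e /orP[]/eqP ->]; apply/imsetP.
    by exists (e, true).
  by exists (e, false).
apply: leq_trans (subset_leq_card sub) _; apply: leq_trans (leq_imset_card _ _) _.
by rewrite card_prod card_bool mulnC.
Qed.

(** The list [r] holds the vertices released from the constraint of landing in [A]. *)
Definition constrained (r : seq H) (f : {ffun H -> T}) : R :=
  (\prod_(u | u \notin r) (f u \in A)%:R) *
  \prod_(e : oedge H) U (f (val e).1) (f (val e).2).

(** Releasing one isolated vertex multiplies the sum by [#|T| / #|A|], since no edge factor sees its
    image; the identity is stated without division. *)
Lemma constrained_free (r : seq H) : uniq r -> {in r, forall u, u \notin nonisolated} ->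
  #|A|%:R ^+ size r * \sum_f constrained r f =
  #|T|%:R ^+ size r * \sum_f constrained [::] f.
Proof.
elim: r => [|u r IH] //= /andP[ur uniqr] iso.
have isou : u \notin nonisolated by apply: iso; rewrite inE eqxx.
have isor : {in r, forall u, u \notin nonisolated}.
  by move=> w wr; apply: iso; rewrite inE wr orbT.
rewrite [in RHS]exprS -mulrA -(IH uniqr isor) mulrCA -(sum_upd _ u) exprSr -mulrA.
congr (_ * _); rewrite mulr_sumr; apply: eq_bigr => f _.
rewrite -sum1_card natr_sum mulr_suml big_mkcond; apply: eq_bigr => t _.
rewrite /constrained [in RHS](bigD1 u) //= updE eqxx.
have -> : \prod_(i | (i \notin r) && (i != u)) (upd f u t i \in A)%:R =
   \prod_(i | i \notin u :: r) (f i \in A)%:R :> R.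
  apply: eq_big => [i|i /andP[_ /negbTE iu]]; last by rewrite updE iu.
  by rewrite inE negb_or andbC.
have -> : \prod_(e : oedge H) U (upd f u t (val e).1) (upd f u t (val e).2) =
    \prod_(e : oedge H) U (f (val e).1) (f (val e).2).
  apply: eq_bigr => e _; rewrite !updE.
  move: isou; rewrite inE negb_exists => /forallP/(_ e)/norP[n1 n2].
  by rewrite ![_ == u]eq_sym (negbTE n1) (negbTE n2).
by case: (t \in A); rewrite ?mul1r ?mul0r.
Qed.

(** Isolated vertices of [H] may go anywhere, so restriction to [A] costs [#|A| / #|T|] only for
    each nonisolated vertex. Their number is at most twice the number of edges, which suits an error
    raised to that power. *)
Lemma hom_sum_nonisolated :
  hom_sum H (fun x y : {x | x \in A} => U (val x) (val y)) *
    #|T|%:R ^+ #|~: nonisolated| <= hom_sum H U * #|A|%:R ^+ #|~: nonisolated|.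
Proof.
have ind01 (r : seq H) (f : {ffun H -> T}) : 0 <= \prod_(u | u \notin r) ((f u \in A)%:R : R) <= 1.
  by apply: unit_prod => u; case: (_ \in A); rewrite ?lexx ?ler01.
have e0 f : 0 <= \prod_(e : oedge H) U (f (val e).1) (f (val e).2) by apply: prodr_ge0.
have key := @constrained_free (enum (~: nonisolated)) (enum_uniq _) _.
rewrite -cardE in key.
apply: (@le_trans _ _ (#|T|%:R ^+ #|~: nonisolated| * \sum_f constrained [::] f)).
  rewrite mulrC ler_wpM2l ?exprn_ge0 //.
  have inj : injective (val : {x | x \in A} -> T) by exact: val_inj.
  have := sum_comp_inj_le (I := H) (G := constrained [::]) inj.
  move=> h; apply: le_trans (h _); last first.
    by move=> f; rewrite mulr_ge0 //; have /andP[] := ind01 [::] f.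
  apply: ler_sum => f _; rewrite /constrained [X in _ <= X * _]big1 ?mul1r; last first.
    by move=> u _; rewrite ffunE (valP (f u)).
  by rewrite le_eqVlt; apply/orP; left; apply/eqP; apply: eq_bigr => e _; rewrite !ffunE.
rewrite -key; last by move=> u; rewrite mem_enum inE.
rewrite mulrC ler_wpM2r ?exprn_ge0 //; apply: ler_sum => f _.
by rewrite /constrained ler_piMl //; have /andP[] := ind01 (enum (~: nonisolated)) f.
Qed.

End Isolated.

(** A positive degree is less than twice the largest power of two not exceeding it. Summing over all
    [l + 1] levels bounds the total degree, and the best level is at least the average. *)
Lemma dyadic_level (T : finType) (S : {set T}) (deg : T -> nat) (l : nat) :
  (forall x, deg x <= 2 ^ l)%N ->
  exists i, (\sum_(x in S) deg x <=
    2 * l.+1 * (2 ^ i * #|[set x in S | 2 ^ i <= deg x]|))%N.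
Proof.
move=> degl.
pose X (i : 'I_l.+1) := (2 ^ i * #|[set x in S | 2 ^ i <= deg x]|)%N.
have [|i Emax] := @bigop.eq_bigmax _ X; first by rewrite card_ord.
exists i; rewrite -/(X i) -Emax -mulnA.
have h1 : (\sum_i X i <= l.+1 * \max_i X i)%N.
  rewrite -[X in (_ <= X * _)%N](card_ord l.+1) -sum_nat_const; apply: leq_sum => j _.
  exact: leq_bigmax.
apply: leq_trans (leq_mul (leqnn 2) h1).
rewrite (_ : \sum_i X i = \sum_(x in S) \sum_(i < l.+1 | 2 ^ i <= deg x) 2 ^ i)%N; last first.
  rewrite (exchange_big_dep predT) //=; apply: eq_bigr => j _.
  by rewrite sum_nat_cond_const /X mulnC; congr (_ * _)%N; apply: eq_card => x.
rewrite big_distrr /=; apply: leq_sum => x _.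
have [->//|d0] := posnP (deg x).
have /andP[t1 t2] := trunc_log_bounds (ltnSn 1) d0.
have tl : (trunc_log 2 (deg x) < l.+1)%N.
  by rewrite ltnS -(leq_exp2l _ _ (ltnSn 1)); apply: leq_trans t1 _.
apply: leq_trans (ltnW t2) _; rewrite expnS leq_mul2l /=.
by rewrite (bigD1 (Ordinal tl)) //= leq_addr.
Qed.

(** If [b / a > 1], its power [2 ^ j] grows doubly exponentially in [j], whereas the error grows
    only exponentially. *)
Lemma tensor_trick (R : realType) (a b C : R) (M : nat) : 0 <= a ->
  (forall j, b ^+ (2 ^ j) <= C * (2 ^+ M) ^+ j * a ^+ (2 ^ j)) -> b <= a.
Proof.
move=> a0 hj; rewrite leNgt; apply/negP => ab.
have b0 : 0 < b by apply: le_lt_trans ab.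
have {}a0 : 0 < a.
  rewrite lt_def a0 andbT; apply/eqP => aE.
  by have := hj 0%N; rewrite aE mulr0; lra.
pose q := b / a; have q1 : 1 < q by rewrite ltr_pdivlMr // mul1r.
have q0 : 0 < q by apply: lt_trans q1.
have hq j : q ^+ (2 ^ j) <= C * (2 ^+ M) ^+ j.
  by rewrite expr_div_n ler_pdivrMr ?exprn_gt0.
have bern n : 1 + n%:R * (q - 1) <= q ^+ n.
  elim: n => [|n IH]; first by rewrite mul0r addr0.
  rewrite exprS -natr1; apply: le_trans (ler_wpM2l (ltW q0) IH).
  have : 0 <= n%:R * (q - 1) * (q - 1) by rewrite !mulr_ge0 // subr_ge0 ltW.
  nra.
have natlt j : (j < 2 ^ j)%N by apply: ltn_expl.
have [J hJ] : exists J, 2 ^+ M.+1 <= q ^+ (2 ^ J).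
  pose J := (Num.truncn (2 ^+ M.+1 / (q - 1))).+1.
  exists J; apply: le_trans (bern _).
  have : 2 ^+ M.+1 / (q - 1) <= (2 ^ J)%N%:R.
    apply: le_trans (ltW (truncnS_gt _)) _; rewrite ler_nat; exact: ltnW.
  rewrite ler_pdivrMr ?subr_gt0 //; lra.
(* Past [J] each further squaring gains at least a factor [2 ^ (M + 1)] against an error of [2 ^ M],
   so all powers of two would be bounded by [K]. *)
pose K := C * (2 ^+ M) ^+ J.
have hi i : 2 ^+ i <= K.
  have e1 : (2 ^+ M.+1) ^+ i <= K * (2 ^+ M) ^+ i :> R.
    apply: (@le_trans _ _ (q ^+ (2 ^ (J + i)))); last by rewrite /K -mulrA -exprD.
    rewrite expnD exprM; apply: (@le_trans _ _ ((q ^+ (2 ^ J)) ^+ i)).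
      by rewrite lerXn2r ?nnegrE ?exprn_ge0 // ltW.
    by rewrite ler_weXn2l ?exprn_ege1 ?(ltW q1) // ltnW.
  by move: e1; rewrite [X in X ^+ i]exprS exprMn ler_pM2r // !exprn_gt0.
have := hi (Num.truncn K).+1; apply/negP; rewrite -ltNge.
apply: lt_trans (truncnS_gt K) _; rewrite -natrX ltr_nat; exact: natlt.
Qed.

(** * Even walks: part (a) up to a logarithmic factor *)

Section RelKernel.
Variables (R : realType) (T : finType) (r : rel T).

Definition relr (x y : T) : R := (r x y)%:R.

Lemma relr01 x y : 0 <= relr x y <= 1.
Proof. by rewrite /relr; case: r; rewrite ?lexx ?ler01. Qed.

(** For the adjacency relation of a graph this is the edge density, and [walk_density] is the
    density of the [s]-subdivision. *)
Definition rel_density : R := (\sum_x \sum_y relr x y) / #|T|%:R ^+ 2.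

Definition walk_density (H : sgraph) s : R :=
  hom_sum H (walk relr s.+1) / #|T|%:R ^+ (#|H| + s * #|{: oedge H}|).

Lemma walk_density_ge0 H s : 0 <= walk_density H s.
Proof.
rewrite divr_ge0 ?exprn_ge0 //; apply: sumr_ge0 => f _; apply: prodr_ge0 => e _.
exact: walk_ge0 relr01 _ _ _.
Qed.

Hypothesis rsym : symmetric r.

Lemma relrC x y : relr x y = relr y x. Proof. by rewrite /relr rsym. Qed.

(** A subset of minimum degree [c] keeps half of the edge weight, and [A] is its best dyadic degree
    level. From a vertex of [A] the first step offers [2 ^ i] choices and each later one at least
    [c]. Only the product of the relative size and the normalised row sum is controlled. *)
Lemma walk_level_set k l : (0 < #|T|)%N -> (#|T| <= 2 ^ l)%N -> 0 < rel_density ->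
  exists (A : {set T}) (del : R), [/\ 0 < del,
    rel_density ^+ k.+1 / (4 ^+ k.+1 * l.+1%:R) <=
      #|A|%:R / #|T|%:R * (del / #|T|%:R ^+ k.+1) &
    forall x, x \in A -> del <= \sum_y walk relr k.+1 x y].
Proof.
set n : R := #|T|%:R => T0 Tl p0; have n0 : 0 < n by rewrite ltr0n.
pose P := \sum_x \sum_y relr x y.
have P0 : 0 < P.
  by move: p0; rewrite /rel_density pmulr_lgt0 // invr_gt0 exprn_gt0.
(* With this penalty the loss over [n] vertices is [P / 2], and the minimum degree is
   [P / (4 * n)]. *)
have g0 : 0 <= P / (2 * n) by rewrite divr_ge0 ?(ltW P0) // mulr_ge0 // ltW.
have [S [Sdeg SP _]] := min_degree_set relrC relr01 g0.
pose c := P / (4 * n).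
have c0 : 0 < c by rewrite divr_gt0 // mulr_gt0.
have cE : P / (2 * n) / 2 = c by rewrite /c; field; rewrite lt0r_neq0.
rewrite cE in Sdeg.
have {}SP : P / 2 <= pair_sum relr S.
  apply: le_trans SP; rewrite (_ : pair_sum _ _ = P); last first.
    rewrite /pair_sum; under eq_bigl do rewrite inE.
    by apply: eq_bigr => x _; apply: eq_bigl => y; rewrite inE.
  rewrite -/n (_ : P / (2 * n) * n = P / 2); first by lra.
  by field; rewrite lt0r_neq0.
pose deg x := #|[set y in S | r x y]|.
have degE x : \sum_(y in S) relr x y = (deg x)%:R.
  rewrite /deg -sum1_card natr_sum [RHS]big_mkcond [LHS]big_mkcond.
  by apply: eq_bigr => y _; rewrite inE /relr; case: (y \in S); case: (r x y).
have degl x : (deg x <= 2 ^ l)%N by apply: leq_trans Tl; apply: max_card.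
have [i hi] := dyadic_level S degl.
set A := [set x in S | _] in hi.
exists A, ((2 ^ i)%:R * c ^+ k); split.
- by rewrite mulr_gt0 ?exprn_gt0 // ltr0n expn_gt0.
- have hi' : pair_sum relr S <= 2 * l.+1%:R * ((2 ^ i)%:R * #|A|%:R).
    rewrite /pair_sum; under eq_bigr do rewrite degE.
    by rewrite -natr_sum -!natrM ler_nat.
  have l0 : 0 < l.+1%:R :> R by rewrite ltr0n.
  have h4 : P / (4 * l.+1%:R) <= (2 ^ i)%:R * #|A|%:R.
    rewrite ler_pdivrMr ?mulr_gt0 //; lra.
  have K0 : 0 < c ^+ k / n ^+ k.+2 by rewrite divr_gt0 ?exprn_gt0.
  have := ler_wpM2r (ltW K0) h4.
  rewrite (_ : (2 ^ i)%:R * #|A|%:R * (c ^+ k / n ^+ k.+2) =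
     #|A|%:R / n * ((2 ^ i)%:R * c ^+ k / n ^+ k.+1)); last first.
    by rewrite (exprS n k.+1); field; rewrite ?expf_neq0 ?lt0r_neq0.
  apply: le_trans; rewrite le_eqVlt; apply/orP; left; apply/eqP.
  have -> : rel_density = P / n ^+ 2 by [].
  rewrite expr_div_n (exprAC n) /c expr_div_n exprMn !(exprS _ k.+1) !(exprS _ k).
  by field; rewrite -/n !expf_neq0 ?(lt0r_neq0 n0) ?pnatr_eq0 //= addrC natr1 pnatr_eq0.
- move=> x; rewrite inE => /andP[xS degx].
  apply: le_trans (walk_row_geS relr01 k (ltW c0) Sdeg xS).
  by rewrite degE ler_wpM2r ?exprn_ge0 ?(ltW c0) // ler_nat.
Qed.

(** Walks of length [2 * k + 2] are cut in the middle, and Cauchy-Schwarz makes their kernel on [A]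
    dense with constant the square of the normalised row sum; [KNRS_kernel] then applies. *)
Lemma walk_density_one_shot (H : sgraph) k l : KNRS R H ->
  (0 < #|T|)%N -> (#|T| <= 2 ^ l)%N -> 0 < rel_density ->
  2^-1 * (rel_density ^+ k.+1 / (4 ^+ k.+1 * l.+1%:R)) ^+ (2 * #|{: oedge H}|) <=
  walk_density H (k.+1 + k).
Proof.
move=> hH T0 Tl p0; have [A [del [del0 hA rowA]]] := walk_level_set k T0 Tl p0.
rewrite /walk_density.
set p := rel_density in p0 hA *; set n : R := #|T|%:R in hA *.
set m := #|{: oedge H}|; set v := #|H|; set s := (k.+1 + k)%N.
have n0 : 0 < n by rewrite ltr0n.
have X0 : 0 < p ^+ k.+1 / (4 ^+ k.+1 * l.+1%:R).
  by rewrite divr_gt0 ?exprn_gt0 // mulr_gt0 ?exprn_gt0 // ltr0n.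
have A0 : (0 < #|A|)%N.
  rewrite lt0n; apply/eqP => cA; move: hA; rewrite cA !mul0r leNgt.
  by rewrite X0.
pose B := {x : T | x \in A}.
have cB : #|{: B}| = #|A| by rewrite card_sig; apply: eq_card => x; rewrite !inE.
have B0 : (0 < #|{: B}|)%N by rewrite cB.
pose M := n ^+ s; have M0 : 0 < M by rewrite exprn_gt0.
pose U := walk relr s.+1.
pose W (x y : B) := U (val x) (val y) / M.
have U0 x y : 0 <= U x y by apply: walk_ge0 relr01 _ _ _.
have Wsym x y : W x y = W y x by rewrite /W /U (walk_sym relrC).
have W01 x y : 0 <= W x y <= 1 by apply: walk_scaled01 relr01.
pose D := (del / n ^+ k.+1) ^+ 2.
have dn0 : 0 < del / n ^+ k.+1 by rewrite divr_gt0 ?exprn_gt0.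
have D0 : 0 < D by rewrite exprn_gt0.
have [|rho _ hker] := KNRS_kernel hH D0 (eps := 1 / 2).
  by apply/andP; split; lra.
have dW : kernel_dense rho D W.
  move=> f f01 _.
  have f0 x : 0 <= f x by have /andP[] := f01 x.
  pose h := walk_push val relr f k.+1.
  have -> : \sum_x \sum_y f x * f y * W x y = (\sum_z h z ^+ 2) / M.
    rewrite -walk_form_even; last exact: relrC.
    rewrite mulr_suml; apply: eq_bigr => x _; rewrite mulr_suml; apply: eq_bigr => y _.
    by rewrite addnS mulrA.
  have hsum : del * \sum_x f x <= \sum_z h z.
    rewrite sum_walk_push mulr_sumr; apply: ler_sum => x _.
    by rewrite mulrC ler_wpM2l //; apply: rowA; apply: valP.
  have sf0 : 0 <= \sum_x f x by apply: sumr_ge0.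
  have cs : (\sum_z h z) ^+ 2 <= n * \sum_z h z ^+ 2.
    have := cauchy_schwarz_sum (fun=> 1) h; under eq_bigr do rewrite mul1r.
    by under [X in X * _]eq_bigr do rewrite expr1n; rewrite sumr_const.
  rewrite ler_pdivlMr // /D.
  have -> : (del / n ^+ k.+1) ^+ 2 * (\sum_x f x) ^+ 2 * M = (del * \sum_x f x) ^+ 2 / n.
    rewrite /M /s exprD !(exprS n k).
    by field; rewrite ?expf_neq0 ?lt0r_neq0.
  rewrite ler_pdivrMr //; apply: le_trans (_ : (\sum_z h z) ^+ 2 <= _).
    by rewrite lerXn2r ?nnegrE ?mulr_ge0 ?(ltW del0) // (le_trans _ hsum) // mulr_ge0 // ltW.
  by rewrite mulrC.
have lo := hker B W B0 Wsym W01 dW.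
have UB0 (x y : B) : 0 <= U (val x) (val y) by [].
(* Used with the identity map, this only undoes the normalisation by [M]; the passage from [A] to
   [T] is left to [up2], which spares the isolated vertices. *)
have up1 := @hom_sum_restrict R H B B id _ _ (@inj_id B) UB0 M0.
have up2 := @hom_sum_nonisolated R H T U A U0.
set i := #|~: nonisolated H| in up2.
have vE : v = (#|nonisolated H| + i)%N by rewrite cardsC.
have v2 : (#|nonisolated H| <= 2 * m)%N := card_nonisolated H.
rewrite ler_pdivlMr ?exprn_gt0 //.
have Ai : 0 < #|A|%:R ^+ i :> R by rewrite exprn_gt0 // ltr0n.
rewrite -(ler_pM2r Ai); apply: le_trans up2.
have {up1}up1 := ler_wpM2r (exprn_ge0 i (ltW n0)) up1.
rewrite -mulrA in up1; apply: le_trans up1; rewrite cB in lo.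
have Mm : 0 < M ^+ m * n ^+ i by rewrite mulr_gt0 ?exprn_gt0.
apply: le_trans (ler_wpM2r (ltW Mm) lo); rewrite -/m -/v.
pose al := #|A|%:R / n.
have al0 : 0 < al by rewrite divr_gt0 // ltr0n.
have al1 : al <= 1 by rewrite ler_pdivrMr // mul1r ler_nat max_card.
have AE : #|A|%:R = al * n by rewrite divfK // lt0r_neq0.
(* Since [al <= 1] and at most [2 * m] vertices are nonisolated, their power of [al] is at least
   [al ^ (2 * m)], which pairs up with [D ^ m]. *)
have key : (p ^+ k.+1 / (4 ^+ k.+1 * l.+1%:R)) ^+ (2 * m) <= D ^+ m * al ^+ #|nonisolated H|.
  apply: (@le_trans _ _ ((al * (del / n ^+ k.+1)) ^+ (2 * m))).
    by rewrite lerXn2r ?nnegrE ?(ltW X0) // mulr_ge0 ?(ltW al0) ?(ltW dn0).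
  rewrite exprMn mulrC /D -exprM ler_pM2l ?exprn_gt0 //.
  by rewrite ler_wiXn2l // ltW.
have hn : 0 <= 2^-1 * (n ^+ (v + s * m) * #|A|%:R ^+ i).
  by rewrite mulr_ge0 ?invr_ge0 // mulr_ge0 ?exprn_ge0 ?(ltW n0).
have := ler_wpM2r hn key => h.
apply: le_trans (_ : _ <= D ^+ m * al ^+ #|nonisolated H| *
  (2^-1 * (n ^+ (v + s * m) * #|A|%:R ^+ i))) _.
  by apply: le_trans h; rewrite le_eqVlt; apply/orP; left; apply/eqP; ring.
rewrite le_eqVlt; apply/orP; left; apply/eqP.
rewrite (_ : 1 - 1 / 2 = 2^-1); last by lra.
rewrite /M -exprM AE vE !exprD !exprMn; ring.
Qed.

End RelKernel.

(** * Tensor powers and the exact bound of part (a) *)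

Section RelPower.
Variables (R : realType) (T : finType) (r : rel T).

Definition rel_sq : rel (T * T) := fun p p' => r p.1 p'.1 && r p.2 p'.2.

Lemma rel_sq_sym : symmetric r -> symmetric rel_sq.
Proof. by move=> rs p p'; rewrite /rel_sq !(rs p.1, rs p.2). Qed.

Lemma relr_sq (p p' : T * T) :
  relr R rel_sq p p' = relr R r p.1 p'.1 * relr R r p.2 p'.2.
Proof. by rewrite /relr /rel_sq -mulnb natrM. Qed.

Lemma rel_density_sq : rel_density R rel_sq = rel_density R r ^+ 2.
Proof.
rewrite /rel_density card_prod natrM -!expr2 expr_div_n; congr (_ / _).
rewrite [RHS]expr2 big_distrlr /= [RHS]pair_bigA /=; apply: eq_bigr => p _.
rewrite big_distrlr /= [RHS]pair_bigA /=; apply: eq_bigr => p' _; exact: relr_sq.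
Qed.

Lemma walk_density_sq H s :
  walk_density R rel_sq H s = walk_density R r H s ^+ 2.
Proof.
rewrite /walk_density card_prod natrM -expr2 -exprM mulnC exprM expr_div_n.
congr (_ / _); rewrite [RHS]expr2 -hom_sum_pair.
apply: eq_bigr => f _; apply: eq_bigr => e _; rewrite -walk_pair.
have walkE s' p p' : walk (relr R rel_sq) s' p p' =
    walk (fun p p' => relr R r p.1 p'.1 * relr R r p.2 p'.2) s' p p'.
  by elim: s' p => [|s' IH] p //=; apply: eq_bigr => z _; rewrite IH relr_sq.
exact: walkE.
Qed.

End RelPower.

(** This is the one-shot bound for the tensor power of order [2 ^ j], reached by repeated squaring:
    densities are raised to that power, while the logarithm of the size is only multiplied by it. *)
Lemma walk_density_power (R : realType) (H : sgraph) k j : KNRS R H ->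
  forall (T : finType) (r : rel T) l, symmetric r ->
  (0 < #|T|)%N -> (#|T| <= 2 ^ l)%N -> 0 < rel_density R r ->
  2^-1 * (rel_density R r ^+ (k.+1 * 2 ^ j) / (4 ^+ k.+1 * (2 ^ j * l).+1%:R)) ^+
    (2 * #|{: oedge H}|) <= walk_density R r H (k.+1 + k) ^+ (2 ^ j).
Proof.
move=> hH; elim: j => [|j IH] T r l rs T0 Tl p0.
  by rewrite muln1 mul1n expr1; apply: walk_density_one_shot.
have TT0 : (0 < #|{: T * T}|)%N by rewrite card_prod muln_gt0 T0.
have TTl : (#|{: T * T}| <= 2 ^ (2 * l))%N.
  by rewrite card_prod mul2n -addnn expnD leq_mul.
have := IH _ (rel_sq r) (2 * l)%N (rel_sq_sym rs) TT0 TTl.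
rewrite rel_density_sq walk_density_sq exprn_gt0 // -!exprM -expnS => /(_ isT).
rewrite (_ : 2 * (k.+1 * 2 ^ j) = k.+1 * 2 ^ j.+1)%N; last by rewrite expnS mulnCA.
by rewrite (_ : 2 ^ j * (2 * l) = 2 ^ j.+1 * l)%N // expnS mulnA (mulnC 2%N).
Qed.

Lemma walk_density_sidorenko (R : realType) (H : sgraph) k (T : finType)
    (r : rel T) : KNRS R H -> symmetric r -> (0 < #|T|)%N ->
  rel_density R r ^+ ((k.+1 + k).+1 * #|{: oedge H}|) <=
  walk_density R r H (k.+1 + k).
Proof.
move=> hH rs T0; set m := #|{: oedge H}|; set p := rel_density R r.
have p0 : 0 <= p.
  rewrite divr_ge0 ?exprn_ge0 //; apply: sumr_ge0 => x _; apply: sumr_ge0 => y _.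
  exact: ler0n.
have [pE|pn0] := eqVneq p 0.
  (* With density 0 the left side is 0 unless [H] has no edge, when both sides are 1. *)
  rewrite pE expr0n muln_eq0 /=; have [m0|_] := eqVneq m 0%N; last first.
    exact: walk_density_ge0.
  rewrite /walk_density -/m m0 muln0 addn0.
  rewrite (_ : hom_sum _ _ = #|T|%:R ^+ #|H|).
    by rewrite divff // expf_neq0 // pnatr_eq0 -lt0n.
  rewrite -hom_sum1; apply: eq_bigr => f _; apply: eq_bigr => e _.
  by have := fintype0 e; rewrite -/m m0.
have {}p0 : 0 < p by rewrite lt_def pn0.
pose l := #|T|.
have Tl : (#|T| <= 2 ^ l)%N by apply: ltnW; apply: ltn_expl.
(* Since [2 ^ j * l + 1 <= 2 ^ j * (l + 1)], the error factor at order [2 ^ j] is at most [C] times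
   the [j]-th power of [2 ^ (2 * m)]. *)
pose C : R := 2 * (4 ^+ k.+1 * l.+1%:R) ^+ (2 * m).
apply: (@tensor_trick R _ _ C (2 * m)); first exact: walk_density_ge0.
move=> j; have := @walk_density_power R H k j hH T r l rs T0 Tl p0.
set t := _ ^+ (2 ^ j); rewrite -/m -/p expr_div_n.
set Y : R := _ ^+ (2 * m) / _ => h.
have j0 : 0 < (2 ^ j * l).+1%:R :> R by rewrite ltr0n.
have Z0 : 0 < (4 ^+ k.+1 * (2 ^ j * l).+1%:R) ^+ (2 * m) :> R.
  by rewrite exprn_gt0 // mulr_gt0 ?exprn_gt0.
have t0 : 0 <= t by rewrite exprn_ge0 // walk_density_ge0.
have E : (p ^+ (k.+1 * 2 ^ j)) ^+ (2 * m) <=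
    2 * t * (4 ^+ k.+1 * (2 ^ j * l).+1%:R) ^+ (2 * m).
  by rewrite -ler_pdivrMr // -/Y; lra.
rewrite -exprM (_ : ((k.+1 + k).+1 * m * 2 ^ j = k.+1 * 2 ^ j * (2 * m))%N); last first.
  by rewrite addSn addnn -mul2n; ring.
rewrite exprM; apply: le_trans E _.
rewrite (_ : C * _ * t =
  2 * t * ((4 ^+ k.+1 * l.+1%:R) ^+ (2 * m) * (2 ^+ (2 * m)) ^+ j)); last by rewrite /C; ring.
rewrite ler_wpM2l ?mulr_ge0 // (exprAC 2) -exprMn.
rewrite lerXn2r ?nnegrE ?mulr_ge0 ?exprn_ge0 // -mulrA ler_pM2l ?exprn_gt0 //.
by rewrite -natrX -natrM ler_nat mulSn mulnC -add1n leq_add2r expn_gt0.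
Qed.

Theorem theorem1p5 (R : realType) (k : nat) (hk : (1 <= k)%N) (H : sgraph)
    (hH : KNRS R H) :
  sidorenko R (subdivision (2 * k - 1)%N H) /\
  weakly_KNRS R (subdivision (2 * k)%N H).
Proof.
split; last exact: weakly_KNRS_subdivision.
case: k hk => // k _.
(* Here [k] has been replaced by its predecessor, so the walks have the even length
   [2 * (k + 1)]. *)
have -> : (2 * k.+1 - 1 = k.+1 + k)%N by lia.
split; first by apply: bipartite_subdivision; rewrite addSn /= oddD addbb.
move=> G G0; rewrite hom_density_K2 card_edges_subdivision // hom_density_subdivision.
exact: walk_density_sidorenko hH (@adj_sym G) G0.
Qed.
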